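(* Let $\bar M^{m+2n}$ be a Kaehler manifold of real dimension $m+2n$, and let $M=M_T\times_f M_\theta$ be an $(m+n)$-dimensional non-trivial warped product pointwise semi-slant submanifold of $\bar M^{m+2n}$, where $M_T$ is a holomorphic submanifold with $\dim M_T=m$ and $M_\theta$ is a proper pointwise slant submanifold with $\dim M_\theta=n$ and slant function $\theta$, where $\sin\theta\ne0$ everywhere. Then: (i) The squared norm of the second fundamental form $h$ of $M$ in $\bar M$ satisfies $$\|h\|^2\ \ge\ 2n\,(\csc^2\theta+\cot^2\theta)\,\|\nabla(\ln f)\|^2 .$$ (ii) If equality holds identically in (i), then $M_T$ is a totally geodesic submanifold of $\bar M$ and $M_\theta$ is a totally umbilical submanifold of $\bar M$. Moreover, $M$ is a minimal submanifold of $\bar M$.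
   Context: All objects are smooth. A Kaehler manifold $(\bar M,g,J)$ is a Riemannian manifold with a $(1,1)$-tensor field $J$ such that $J^2=-I$, $g(JX,JY)=g(X,Y)$ and $\bar\nabla J=0$, where $\bar\nabla$ is the Levi-Civita connection of $\bar M$. A submanifold $N$ of $\bar M$ is holomorphic if $J(T_pN)\subset T_pN$ for all $p\in N$. It is pointwise slant if at each $p\in N$ the angle between $JX$ and $T_pN$ is the same for all nonzero $X\in T_pN$. A pointwise slant submanifold is proper if it contains no totally real points, i.e. $\cos\theta\ne0$ everywhere. A distribution $D$ on a submanifold $M$ is pointwise slant with slant function $\theta$ if, at each $p\in M$, the angle between $JX$ and $D_p$ equals $\theta(p)$ for every nonzero $X\in D_p$. A submanifold $M$ of $\bar M$ is pointwise semi-slant if $TM=D^T\oplus D^\theta$ is an orthogonal direct sum of distributions with $JD^T=D^T$ and $D^\theta$ pointwise slant with slant function $\theta$ (a function on $M$, called the slant function of $M$). For Riemannian manifolds $(B,g_1)$, $(F,g_2)$ and $f:B\to(0,\infty)$, the warped product $B\times_fF$ is $B\times F$ with metric $\pi^*g_1+(f\circ\pi)^2\eta^*g_2$, where $\pi,\eta$ are the projections. It is non-trivial if $f$ is not constant. A warped product pointwise semi-slant submanifold $M=M_T\times_fM_\theta$ is an isometrically immersed warped product with $D^T=TM_T$ and $D^\theta=TM_\theta$ (the tangent distributions to the two families of slices), so $f$ is a function on $M_T$. The conditions on $M_T$ and $M_\theta$ refer to the slices $M_T\times\{q\}$ and $\{p\}\times M_\theta$, viewed as submanifolds of $\bar M$.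 The second fundamental form is $h(X,Y)=\bar\nabla_XY-\nabla_XY$ with $\nabla$ the Levi-Civita connection of $M$; $\|h\|^2=\sum_{i,j}g(h(E_i,E_j),h(E_i,E_j))$ for an orthonormal frame $\{E_i\}$ of $M$; $\nabla(\ln f)$ is the gradient of $\ln f$. *)

(* Defs.v *)
From HB Require Import structures.
From mathcomp Require Import all_boot all_order all_algebra.
From mathcomp Require Import all_classical all_reals.
From mathcomp Require Import topology normedtype derive exp trigo.
Set Implicit Arguments.
Unset Strict Implicit.
Unset Printing Implicit Defensive.
Import Order.TTheory GRing.Theory Num.Theory.
Import numFieldNormedType.Exports.

Local Open Scope classical_set_scope.
Local Open Scope ring_scope.

(* C^oo on an open set U: every iterated directional derivative of f is
   differentiable at every point of U. *)
Definition smooth_on (R : realType) (V W : normedModType R) (U : set V)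
    (f : V -> W) : Prop :=
  forall (s : seq V) (x : V), U x ->
    differentiable (foldr (fun v g => 'D_v g) f s) x.

(* An atlas with one chart around each point.  Every smooth structure contains
   such an atlas, and smoothness may be tested on it.  [chart p] is meaningful
   on [chart_dom p] only, and [param p] is its inverse, meaningful on
   [chart_img p] only. *)
Record charted_space (R : realType) (n : nat) := ChartedSpace {
  carrier :> topologicalType;
  chart_dom : carrier -> set carrier;
  chart : carrier -> carrier -> 'rV[R]_n;
  param : carrier -> 'rV[R]_n -> carrier }.

Definition chart_img (R : realType) (n : nat) (M : charted_space R n) (p : M) :
    set 'rV[R]_n :=
  chart p @` chart_dom p.

Definition smooth_manifold (R : realType) (n : nat) (M : charted_space R n) :
    Prop :=
  [/\ hausdorff_space M,
      @second_countable M,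
      forall p : M,
        [/\ chart_dom p p, open (chart_dom p) & open (chart_img p)] /\
        [/\ forall x, chart_dom p x -> param p (chart p x) = x,
            forall x, chart_dom p x -> {for x, continuous (chart p)}
          & forall y, chart_img p y -> {for y, continuous (param p)}]
    & forall p q : M,
        smooth_on [set y | chart_img p y /\ chart_dom q (param p y)]
          (chart q \o param p)].

Definition prod_space (R : realType) (m n : nat) (B : charted_space R m)
    (F : charted_space R n) : charted_space R (m + n) :=
  @ChartedSpace R (m + n) (B * F)%type
    (fun p => chart_dom p.1 `*` chart_dom p.2)
    (fun p x => row_mx (chart p.1 x.1) (chart p.2 x.2))
    (fun p y => (param p.1 (lsubmx y), param p.2 (rsubmx y))).

Definition smooth_map (R : realType) (m n : nat) (M : charted_space R m)
    (N : charted_space R n) (F : M -> N) : Prop :=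
  continuous F /\
  forall (p : M) (q : N),
    smooth_on [set y | chart_img p y /\ chart_dom q (F (param p y))]
      (chart q \o F \o param p).

Definition smooth_function (R : realType) (n : nat) (M : charted_space R n)
    (f : M -> R) : Prop :=
  forall p : M, smooth_on (chart_img p) (f \o param p : 'rV[R]_n -> R^o).

(* The tangent space at x is 'rV[R]_n, a row vector standing for the tangent
   vector with these components in the chart attached to x itself.  Linear
   maps between tangent spaces act on the right.  [trans p q x] changes
   components at x from the chart p to the chart q. *)
Definition trans (R : realType) (n : nat) (M : charted_space R n)
    (p q x : M) : 'M[R]_n :=
  jacobian (chart q \o param p) (chart p x).

Definition tangent_map (R : realType) (m n : nat) (M : charted_space R m)
    (N : charted_space R n) (F : M -> N) (x : M) : 'M[R]_(m, n) :=
  jacobian (chart (F x) \o F \o param x) (chart x x).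

(* Components of tensor fields in the chart p: vector fields V along a map F
   (V x is tangent to N at F x; q is a chart of N), endomorphism fields J,
   and bilinear forms g, given at x by their Gram matrix in the chart x. *)
Definition field_in (R : realType) (m n : nat) (M : charted_space R m)
    (N : charted_space R n) (F : M -> N) (V : M -> 'rV[R]_n) (p : M) (q : N)
    (y : 'rV[R]_m) : 'rV[R]_n :=
  let x := param p y in V x *m trans (F x) q (F x).

Definition endo_in (R : realType) (n : nat) (M : charted_space R n)
    (J : M -> 'M[R]_n) (p : M) (y : 'rV[R]_n) : 'M[R]_n :=
  let x := param p y in trans p x x *m J x *m trans x p x.

Definition metric_in (R : realType) (n : nat) (M : charted_space R n)
    (g : M -> 'M[R]_n) (p : M) (y : 'rV[R]_n) : 'M[R]_n :=
  let x := param p y in trans p x x *m g x *m (trans p x x)^T.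

Definition smooth_field_on (R : realType) (n : nat) (M : charted_space R n)
    (U : set M) (X : M -> 'rV[R]_n) : Prop :=
  forall p : M,
    smooth_on [set y | chart_img p y /\ U (param p y)] (field_in idfun X p p).

Definition ip (R : realType) (n : nat) (G : 'M[R]_n) (u v : 'rV[R]_n) : R :=
  (u *m G *m v^T) 0 0.

Definition tnorm (R : realType) (n : nat) (G : 'M[R]_n) (u : 'rV[R]_n) : R :=
  Num.sqrt (ip G u u).

Definition riemannian_metric (R : realType) (n : nat) (M : charted_space R n)
    (g : M -> 'M[R]_n) : Prop :=
  [/\ forall x, (g x)^T = g x,
      forall x v, v != 0 -> 0 < ip (g x) v v
    & forall p, smooth_on (chart_img p) (metric_in g p)].

(* Levi-Civita connection in the chart p: the k-th component of
   [christoffel g p y u v] is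
     sum_ij Gamma^k_ij u^i v^j,
     Gamma^k_ij = 1/2 sum_l g^kl (d_i g_jl + d_j g_il - d_l g_ij). *)
Definition christoffel (R : realType) (n : nat) (M : charted_space R n)
    (g : M -> 'M[R]_n) (p : M) (y u v : 'rV[R]_n) : 'rV[R]_n :=
  let G := metric_in g p in
  let dG (l i j : 'I_n) := ('D_(delta_mx 0 l) G y) i j in
  \row_k \sum_i \sum_j
    (2^-1 * \sum_l invmx (G y) k l * (dG i j l + dG j i l - dG l i j))
      * u 0 i * v 0 j.

(* Covariant derivative at x, in the direction u tangent to M at x, of the
   field V along F : M -> N, for the Levi-Civita connection of (N, g);
   F := idfun gives the Levi-Civita connection on fields of M itself. *)
Definition cov (R : realType) (m n : nat) (M : charted_space R m)
    (N : charted_space R n) (g : N -> 'M[R]_n) (F : M -> N)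
    (V : M -> 'rV[R]_n) (x : M) (u : 'rV[R]_m) : 'rV[R]_n :=
  'D_u (field_in F V x (F x)) (chart x x)
  + christoffel g (F x) (chart (F x) (F x)) (u *m tangent_map F x) (V x).

Definition kaehler (R : realType) (n : nat) (M : charted_space R n)
    (g J : M -> 'M[R]_n) : Prop :=
  [/\ smooth_manifold M,
      riemannian_metric g,
      forall p, smooth_on (chart_img p) (endo_in J p)
    & [/\ forall x, J x *m J x = - 1%:M,
          forall x u v, ip (g x) (u *m J x) (v *m J x) = ip (g x) u v
        & forall (U : set M) (Y : M -> 'rV[R]_n), open U ->
            smooth_field_on U Y -> forall x, U x -> forall u,
            cov g idfun (fun z => Y z *m J z) x u
            = cov g idfun Y x u *m J x]].

(* A submanifold of (N, g) is given by a smooth map F : M -> N whose tangent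
   maps are injective; its metric is the induced one. *)
Definition pullback (R : realType) (m n : nat) (M : charted_space R m)
    (N : charted_space R n) (F : M -> N) (g : N -> 'M[R]_n) (x : M) :
    'M[R]_m :=
  tangent_map F x *m g (F x) *m (tangent_map F x)^T.

Definition sff_field (R : realType) (m n : nat) (M : charted_space R m)
    (N : charted_space R n) (g : N -> 'M[R]_n) (F : M -> N)
    (X Y : M -> 'rV[R]_m) (x : M) : 'rV[R]_n :=
  cov g F (fun z => Y z *m tangent_map F z) x (X x)
  - cov (pullback F g) idfun Y x (X x) *m tangent_map F x.

(* The field with constant components u in the chart x. *)
Definition coord_field (R : realType) (n : nat) (M : charted_space R n)
    (x : M) (u : 'rV[R]_n) (z : M) : 'rV[R]_n :=
  u *m trans x z z.

(* [sff_field] is tensorial, so its value at x on two tangent vectors may be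
   computed on any extensions of them to fields near x. *)
Definition sff (R : realType) (m n : nat) (M : charted_space R m)
    (N : charted_space R n) (g : N -> 'M[R]_n) (F : M -> N) (x : M)
    (u v : 'rV[R]_m) : 'rV[R]_n :=
  sff_field g F (coord_field x u) (coord_field x v) x.

(* The rows of E form an orthonormal basis for the inner product G. *)
Definition orthonormal_basis (R : realType) (n : nat) (G E : 'M[R]_n) : Prop :=
  E *m G *m E^T = 1%:M.

Definition sff_sqnorm (R : realType) (m n : nat) (M : charted_space R m)
    (N : charted_space R n) (g : N -> 'M[R]_n) (F : M -> N) (x : M)
    (E : 'M[R]_m) : R :=
  \sum_i \sum_j
    ip (g (F x)) (sff g F x (row i E) (row j E)) (sff g F x (row i E) (row j E)).

Definition mean_curvature (R : realType) (m n : nat) (M : charted_space R m)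
    (N : charted_space R n) (g : N -> 'M[R]_n) (F : M -> N) (x : M)
    (E : 'M[R]_m) : 'rV[R]_n :=
  m%:R^-1 *: \sum_i sff g F x (row i E) (row i E).

Definition totally_geodesic (R : realType) (m n : nat) (M : charted_space R m)
    (N : charted_space R n) (g : N -> 'M[R]_n) (F : M -> N) : Prop :=
  forall x u v, sff g F x u v = 0.

Definition totally_umbilical (R : realType) (m n : nat) (M : charted_space R m)
    (N : charted_space R n) (g : N -> 'M[R]_n) (F : M -> N) : Prop :=
  forall x E, orthonormal_basis (pullback F g x) E ->
  forall u v,
    sff g F x u v = ip (pullback F g x) u v *: mean_curvature g F x E.

Definition minimal (R : realType) (m n : nat) (M : charted_space R m)
    (N : charted_space R n) (g : N -> 'M[R]_n) (F : M -> N) : Prop :=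
  forall x E, orthonormal_basis (pullback F g x) E ->
    mean_curvature g F x E = 0.

Definition gradient (R : realType) (n : nat) (M : charted_space R n)
    (g : M -> 'M[R]_n) (phi : M -> R) (x : M) : 'rV[R]_n :=
  (\row_i 'D_(delta_mx 0 i) (phi \o param x : 'rV[R]_n -> R^o) (chart x x))
    *m invmx (g x).

Definition holomorphic (R : realType) (m n : nat) (M : charted_space R m)
    (N : charted_space R n) (J : N -> 'M[R]_n) (F : M -> N) : Prop :=
  forall x, (tangent_map F x *m J (F x) <= tangent_map F x)%MS.

(* The angle between v and the row space of S is a: v projects orthogonally
   onto u in S, and cos a = |u| / |v|. *)
Definition subspace_angle (R : realType) (r n : nat) (G : 'M[R]_n)
    (v : 'rV[R]_n) (S : 'M[R]_(r, n)) (a : R) : Prop :=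
  exists u : 'rV[R]_n,
    [/\ (u <= S)%MS,
        forall w : 'rV[R]_n, (w <= S)%MS -> ip G (v - u) w = 0
      & a = acos (tnorm G u / tnorm G v)].

(* A distribution of rank r on M: at x, the row space of D x. *)
Definition slant_distribution (R : realType) (m n r : nat)
    (M : charted_space R m) (N : charted_space R n) (g J : N -> 'M[R]_n)
    (F : M -> N) (D : M -> 'M[R]_(r, m)) (theta : M -> R) : Prop :=
  forall x (X : 'rV[R]_m), (X <= D x)%MS -> X != 0 ->
    subspace_angle (g (F x)) (X *m tangent_map F x *m J (F x))
      (D x *m tangent_map F x) (theta x).

Definition slant_submanifold (R : realType) (m n : nat)
    (M : charted_space R m) (N : charted_space R n) (g J : N -> 'M[R]_n)
    (F : M -> N) (theta : M -> R) : Prop :=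
  slant_distribution g J F (fun=> 1%:M : 'M[R]_m) theta.

Definition proper_slant_submanifold (R : realType) (m n : nat)
    (M : charted_space R m) (N : charted_space R n) (g J : N -> 'M[R]_n)
    (F : M -> N) (theta : M -> R) : Prop :=
  slant_submanifold g J F theta /\ forall x, cos (theta x) != 0.

Definition semi_slant (R : realType) (m n r s : nat)
    (M : charted_space R m) (N : charted_space R n) (g J : N -> 'M[R]_n)
    (F : M -> N) (DT : M -> 'M[R]_(r, m)) (Dtheta : M -> 'M[R]_(s, m))
    (theta : M -> R) : Prop :=
  [/\ forall x, (1%:M <= DT x + Dtheta x)%MS,
      forall x, DT x *m pullback F g x *m (Dtheta x)^T = 0,
      forall x, (DT x *m tangent_map F x *m J (F x)
                 == DT x *m tangent_map F x)%MS
    & slant_distribution g J F Dtheta theta].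

Definition warped_metric (R : realType) (m n : nat) (B : charted_space R m)
    (F : charted_space R n) (g1 : B -> 'M[R]_m) (g2 : F -> 'M[R]_n)
    (f : B -> R) (x : prod_space B F) : 'M[R]_(m + n) :=
  block_mx (g1 x.1) 0 0 (f x.1 ^+ 2 *: g2 x.2).

(* The tangent distributions to the slices B x {q} and {p} x F. *)
Definition tangent_base (R : realType) (m n : nat) (B : charted_space R m)
    (F : charted_space R n) (x : prod_space B F) : 'M[R]_(m, m + n) :=
  row_mx 1%:M 0.

Definition tangent_fiber (R : realType) (m n : nat) (B : charted_space R m)
    (F : charted_space R n) (x : prod_space B F) : 'M[R]_(n, m + n) :=
  row_mx 0 1%:M.

Definition base_slice (R : realType) (m n : nat) (B : charted_space R m)
    (F : charted_space R n) (T : Type) (Phi : prod_space B F -> T) (q : F) :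
    B -> T := fun p => Phi (p, q).

Definition fiber_slice (R : realType) (m n : nat) (B : charted_space R m)
    (F : charted_space R n) (T : Type) (Phi : prod_space B F -> T) (p : B) :
    F -> T := fun q => Phi (p, q).

(* Phi realizes the warped product B x_f F, with base metric g1 and fibre
   metric g2, as an isometrically immersed submanifold of (N, g) which is
   pointwise semi-slant for the tangent distributions of the two families of
   slices. *)
Definition warped_semi_slant (R : realType) (m n k : nat)
    (B : charted_space R m) (F : charted_space R n) (N : charted_space R k)
    (g1 : B -> 'M[R]_m) (g2 : F -> 'M[R]_n) (g J : N -> 'M[R]_k)
    (f : B -> R) (Phi : prod_space B F -> N) (theta : prod_space B F -> R) :
    Prop :=
  [/\ smooth_manifold B /\ riemannian_metric g1,
      smooth_manifold F /\ riemannian_metric g2,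
      smooth_function f /\ forall p, 0 < f p,
      smooth_map Phi /\ forall x, pullback Phi g x = warped_metric g1 g2 f x
    & semi_slant g J Phi (@tangent_base R m n B F) (@tangent_fiber R m n B F)
        theta].

(* Main.v *)
(* Write T for the differential of the immersion, D^T and D^theta for the tangent
   spaces of the slices, and F for the normal part of J on D^theta.
   Differentiating g(JX, Z) = 0 for X in D^T and Z in D^theta, with g and J
   parallel, gives g(D_U X, JZ) = g(D_U Z, JX) for every tangent U, and the right
   side only involves the Levi-Civita connection of the warped product metric.
   As sin theta <> 0 and the normal space has dimension n, it is spanned by
   F D^theta.  Hence h(D^T, D^T) = 0, while for Z in D^theta and X in D^T
     g(h(Z, X), JW) = - (JX ln f) g(Z, W) - (X ln f) g(Z, JW)
   determines h(Z, X), with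
     |h(Z, X)|^2 = csc^2 theta ((JX ln f)^2 + cos^2 theta (X ln f)^2) |Z|^2.
   Summing over an orthonormal frame adapted to the splitting, the mixed terms
   give exactly the lower bound, and the difference of the two sides is
   |h(D^theta, D^theta)|^2.  In the equality case h is therefore purely mixed:
   M is minimal, and the second fundamental forms of the slices are those of the
   slices of the warped product. *)
Require Import Defs.
From HB Require Import structures.
From mathcomp Require Import all_boot all_order all_algebra.
From mathcomp Require Import all_classical all_reals.
From mathcomp Require Import topology normedtype landau derive exp trigo.
From mathcomp Require Import ring lra.
Set Implicit Arguments.
Unset Strict Implicit.
Unset Printing Implicit Defensive.
Import Order.TTheory GRing.Theory Num.Theory.
Import numFieldNormedType.Exports.
Local Open Scope classical_set_scope.
Local Open Scope ring_scope.

(** The constant comes from the invariance of D^T. J sends an orthonormal frame of D^T to another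
    one, so the sums of (JX ln f)^2 and of (X ln f)^2 over the frame both equal |grad ln f|^2, and
    csc^2 (1 + cos^2) = csc^2 + cot^2 is left for each unit Z in D^theta. There are n such Z in a
    frame, and each pair counts twice, as h(X, Z) and as h(Z, X). The cos^2 arises because JW,
    against which h is tested, is not normal: passing from D_Z X to h(Z, X) subtracts (X ln f) Z,
    whose product with JW need not vanish. All computations take place at one point x, in the chart
    at x and the chart at its image. There tangent vectors extend with constant components, and D_U
    V is a second derivative of the coordinate expression plus a Christoffel term, symmetric by
    Young's theorem. An identity that gets differentiated, such as g(JX, Z) = 0, must hold near x,
    where tangent spaces refer to other charts; transition matrices bring it back to the chart at
    x. *)

Section Calculus.
Context {R : realType}.

(** * Differentiation of matrix-valued functions *)

(** The first order expansion of f at x is also one of g, since only the germ enters; uniqueness of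
    the differential then identifies its linear part with the differential of g. *)
Lemma near_eq_differentiable (V W : normedModType R) (f g : V -> W) (x : V) :
  (\forall y \near x, f y = g y) -> differentiable f x -> differentiable g x.
Proof.
move=> fg df.
have fgx : f x = g x by exact: nbhs_singleton fg.
have H : g \o shift x = cst (g x) + 'd f x +o_ (0 : V) id.
  apply/eqaddoP => e e0.
  have [_ /eqaddoP/(_ e e0)] := (diff_locallyP x f).1 df.
  have : \forall h \near (0 : V), f (h + x) = g (h + x).
    by move: fg; rewrite (near_shift 0 x); apply: filterS => h /=; rewrite subr0 => ->.
  by apply: filterS2 => h /= + ; rewrite !fctE /= -fgx => <-.
have [dc _] := (diff_locallyP x f).1 df.
apply/diff_locallyP; have E := diff_unique dc H.
by rewrite E.
Qed.

Lemma differentiable_mxP (V : normedModType R) m n (A : V -> 'M[R]_(m, n)) x :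
  differentiable A x <->
  forall i j, differentiable (fun y => A y i j : R^o) x.
Proof.
split=> [dA i j|dA].
  apply: (@differentiable_comp _ _ _ _ A (fun N : 'M[R]_(m, n) => N i j : R^o)) => //.
  exact: differentiable_coord.
have -> : A = fun y => \sum_i \sum_j (A y i j *: delta_mx i j).
  by apply/funext => y; exact: matrix_sum_delta.
have -> : (fun y => \sum_i \sum_j (A y i j *: delta_mx i j)) =
  \sum_i \sum_j (fun y => A y i j *: (delta_mx i j : 'M[R]_(m, n))).
  by apply/funext => y; rewrite fct_sumE; apply: eq_bigr => i _; rewrite fct_sumE.
apply: differentiable_sum => i; apply: differentiable_sum => j.
exact: differentiableZl.
Qed.

Lemma derive_coord (V : normedModType R) m n (A : V -> 'M[R]_(m, n)) x v i j :
  differentiable A x -> 'D_v (fun y => A y i j : R^o) x = ('D_v A x) i j.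
Proof. by move=> dA; rewrite derive_mx ?mxE//; exact: diff_derivable. Qed.

Lemma derive_comp (U V W : normedModType R) (f : U -> V) (g : V -> W) x v :
  differentiable f x -> differentiable g (f x) ->
  'D_v (g \o f) x = 'D_('D_v f x) g (f x).
Proof.
move=> df dg; rewrite !deriveE//; last exact: differentiable_comp.
by rewrite diff_comp.
Qed.

Lemma differentiable_mulmx (V : normedModType R) m n p (A : V -> 'M[R]_(m, n))
  (B : V -> 'M[R]_(n, p)) x :
  differentiable A x -> differentiable B x ->
  differentiable (fun y => A y *m B y) x.
Proof.
move=> /differentiable_mxP dA /differentiable_mxP dB.
apply/differentiable_mxP => i j.
have -> : (fun y => (A y *m B y) i j : R^o) =
    \sum_k ((fun y => A y i k : R) * (fun y => B y k j : R)).
  by apply/funext => y; rewrite mxE fct_sumE.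
by apply: differentiable_sum => k; apply: differentiableM.
Qed.

Lemma derive_mulmx (V : normedModType R) m n p (A : V -> 'M[R]_(m, n))
  (B : V -> 'M[R]_(n, p)) x v :
  differentiable A x -> differentiable B x ->
  'D_v (fun y => A y *m B y) x = 'D_v A x *m B x + A x *m 'D_v B x.
Proof.
move=> dA dB; apply/matrixP => i j.
rewrite -derive_coord; last exact: differentiable_mulmx.
have -> : (fun y => (A y *m B y) i j : R^o) =
    \sum_k ((fun y => A y i k : R) * (fun y => B y k j : R)).
  by apply/funext => y; rewrite mxE fct_sumE.
have dAk k : differentiable (fun y => A y i k : R) x.
  by move/differentiable_mxP: dA; apply.
have dBk k : differentiable (fun y => B y k j : R) x.
  by move/differentiable_mxP: dB; apply.
rewrite derive_sum => [|k]; last by apply/diff_derivable/differentiableM.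
rewrite !mxE -big_split; apply: eq_bigr => k _ /=.
rewrite deriveM; [|exact: diff_derivable..].
rewrite (derive_coord v i k dA) (derive_coord v k j dB) /GRing.scale/=.
rewrite addrC; congr (_ + _); exact: mulrC.
Qed.

Lemma differentiable_trmx (V : normedModType R) m n (A : V -> 'M[R]_(m, n)) x :
  differentiable A x -> differentiable (fun y => (A y)^T) x.
Proof.
move=> /differentiable_mxP dA; apply/differentiable_mxP => i j.
have -> : (fun y => (A y)^T i j : R^o) = (fun y => A y j i : R^o).
  by apply/funext => y; rewrite mxE.
exact: dA.
Qed.

Lemma derive_trmx (V : normedModType R) m n (A : V -> 'M[R]_(m, n)) x v :
  differentiable A x -> 'D_v (fun y => (A y)^T) x = ('D_v A x)^T.
Proof.
move=> dA; apply/matrixP => i j; rewrite mxE.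
rewrite -derive_coord; last exact: differentiable_trmx.
have -> : (fun y => (A y)^T i j : R^o) = (fun y => A y j i : R^o).
  by apply/funext => y; rewrite mxE.
exact: derive_coord.
Qed.

Lemma derive_linear (V W : normedModType R) (f : V -> W) x :
  differentiable f x -> linear (fun v => 'D_v f x).
Proof. by move=> df a u v; rewrite !deriveE// linearP. Qed.

Lemma derive_rowE (W : normedModType R) n
  (f : 'rV[R]_n -> W) x v : differentiable f x ->
  'D_v f x = \sum_i v 0 i *: 'D_(delta_mx 0 i) f x.
Proof.
move=> df; rewrite deriveE// [v in LHS]row_sum_delta linear_sum.
by apply: eq_bigr => i _; rewrite linearZ deriveE.
Qed.

End Calculus.

(** * Symmetry of second derivatives *)

Section Young.
Context {R : realType} {V : normedModType R}.

Lemma derivative_error (g : V -> R^o) (x : V) (e : R) :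
  differentiable g x -> 0 < e ->
  exists2 d, 0 < d & forall h, `|h| < d ->
    `|g (h + x) - g x - 'D_h g x| <= e * `|h|.
Proof.
move=> dg e0; have [_ /eqaddoP/(_ e e0)] := (diff_locallyP x g).1 dg.
move=> /nbhs_ballP[d /= d0 H]; exists d => // h hd.
have := H h; rewrite /= -ball_normE /= sub0r normrN => /(_ hd).
by rewrite !fctE /= opprD addrA deriveE.
Qed.

Lemma is_derive_line (W : normedModType R) (g : V -> W) (x u : V) (s : R) :
  differentiable g (s *: u + x) ->
  is_derive s 1 (fun r : R => g (r *: u + x)) ('D_u g (s *: u + x)).
Proof.
move=> /(@diff_derivable _ _ _ _ _ u) dg.
have E : (fun h : R => h^-1 *: (((fun r : R => g (r *: u + x)) \o shift s) (h *: 1)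
    - g (s *: u + x))) =
    (fun h : R => h^-1 *: ((g \o shift (s *: u + x)) (h *: u) - g (s *: u + x))).
  by apply/funext => h /=; rewrite [h *: 1]mulr1 scalerDl addrA.
by apply: DeriveDef; [rewrite /derivable E|rewrite /derive E].
Qed.

(* Mean value theorem applied to [s |-> f (x + s u + t v) - f (x + s u)]. *)
Lemma second_difference (f : V -> R^o) (x u v : V) (e : R) :
  (\forall y \near x, differentiable f y) -> differentiable ('D_u f) x ->
  0 < e ->
  exists2 d, 0 < d & forall t, 0 < t < d ->
    `|(f (t *: u + (t *: v + x)) - f (t *: v + x) - (f (t *: u + x) - f x))
      - t ^+ 2 * 'D_v ('D_u f) x| <= e * t ^+ 2.
Proof.
move=> fd dD e0.
(* The summand 1 keeps [k] positive when u = v = 0. The tolerance e / (2 k) makes each of the two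
   expansion errors at most e / 2 * t, since the increments have norm at most t (|u| + |v|). *)
set k := `|u| + `|v| + 1.
have k0 : 0 < k by rewrite /k ltr_wpDl // addr_ge0.
have ek : 0 < e / (2 * k) by rewrite divr_gt0 // mulr_gt0.
have [d d0 Hd] := derivative_error dD ek.
move/nbhs_ballP : fd => [r /= r0 Hr].
have small (s t : R) c : 0 <= s -> s <= t -> 0 <= t -> t < c / k ->
    `|s *: u + t *: v| < c /\ `|s *: u| < c.
  move=> s0 st t0; rewrite ltr_pdivlMr// => tc.
  have tv : 0 <= t * `|v| by rewrite mulr_ge0.
  have su : s * `|u| <= t * `|u| by rewrite ler_wpM2r.
  have H1 : t * (`|u| + `|v|) < c.
    by apply: le_lt_trans tc; rewrite ler_wpM2l// /k lerDl.
  rewrite mulrDr in H1.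
  split; last by rewrite normrZ ger0_norm//; lra.
  by apply: le_lt_trans (ler_normD _ _) _; rewrite !normrZ !ger0_norm//; lra.
exists (Num.min (d / k) (r / k)); first by rewrite lt_min !divr_gt0.
move=> t /andP[t0]; rewrite lt_min => /andP[td tr].
have fdiff s : 0 <= s -> s <= t ->
    differentiable f (s *: u + (t *: v + x)) /\ differentiable f (s *: u + x).
  move=> s0 st; have [H1 H2] := small _ _ _ s0 st (ltW t0) tr.
  by split; apply: Hr; rewrite -ball_normE /= distrC ?addrA addrK.
pose g s := f (s *: u + (t *: v + x)) - f (s *: u + x) : R^o.
pose dg s := 'D_u f (s *: u + (t *: v + x)) - 'D_u f (s *: u + x).
have gd s : 0 <= s -> s <= t -> is_derive s 1 g (dg s).
  move=> s0 st; have [H1 H2] := fdiff _ s0 st.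
  by apply: is_deriveB; apply: is_derive_line.
have gc : {within `[0, t], continuous g}.
  apply: derivable_within_continuous => s; rewrite in_itv /= => /andP[s0 st].
  exact: (@ex_derive _ _ _ _ _ _ _ (gd s s0 st)).
have gdo s : s \in `]0, t[%R -> is_derive s 1 g (dg s).
  by rewrite in_itv /= => /andP[s0 st]; apply: gd; exact: ltW.
have [s] := MVT t0 gdo gc.
rewrite in_itv /= => /andP[/ltW s0 /ltW st].
rewrite subr0 => Eg.
have -> : f (t *: u + (t *: v + x)) - f (t *: v + x) - (f (t *: u + x) - f x)
    = g t - g 0.
  by rewrite /g scale0r !add0r; lra.
rewrite Eg.
have [K1 K2] := small _ _ _ s0 st (ltW t0) td.
have := Hd _ K1; have := Hd _ K2.
rewrite -[s *: u + t *: v + x]addrA /dg.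
set A := 'D_u f (_ + (_ + _)); set B := 'D_u f (s *: u + x); set C := 'D_u f x.
have lin := derive_linear dD.
have -> : 'D_(s *: u + t *: v) ('D_u f) x
    = 'D_(s *: u) ('D_u f) x + t * 'D_v ('D_u f) x.
  by rewrite addrC lin addrC.
set P := 'D_(s *: u) _ x; set Q := 'D_v _ x => HB HA.
have N1 : `|s *: u + t *: v| <= t * (`|u| + `|v|).
  apply: le_trans (ler_normD _ _) _; rewrite !normrZ !ger0_norm ?(ltW t0)// mulrDr.
  by rewrite lerD2r ler_wpM2r.
have N2 : `|s *: u| <= t * (`|u| + `|v|).
  by rewrite normrZ ger0_norm// mulrDr ler_wpDr ?ler_wpM2r// mulr_ge0// ltW.
have N3 : e / (2 * k) * (t * (`|u| + `|v|)) <= e / 2 * t.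
  rewrite invfM -!mulrA ler_pM2l// ler_pM2l ?invr_gt0// mulrCA ler_piMr ?(ltW t0)//.
  by rewrite mulrC ler_pdivrMr// mul1r /k lerDl.
have HB' : `|B - C - P| <= e / 2 * t.
  by apply: le_trans HB _; apply: le_trans N3; rewrite ler_wpM2l// ltW.
have HA' : `|A - C - (P + t * Q)| <= e / 2 * t.
  by apply: le_trans HA _; apply: le_trans N3; rewrite ler_wpM2l// ltW.
have AB : `|(A - B) - t * Q| <= e * t.
  have -> : A - B - t * Q = (A - C - (P + t * Q)) - (B - C - P) by lra.
  by apply: le_trans (ler_normB _ _) _; lra.
have -> : (A - B) * t - t ^+ 2 * Q = t * ((A - B) - t * Q) by ring.
by rewrite normrM (ger0_norm (ltW t0)) expr2 [e * _]mulrCA ler_pM2l.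
Qed.

(** The second difference is symmetric in u and v, so for one small t it is within e / 2 * t^2 of
    t^2 times either iterated derivative; and e is arbitrary. *)
Lemma derive_swap_scalar (f : V -> R^o) (x u v : V) :
  (\forall y \near x, differentiable f y) ->
  differentiable ('D_u f) x -> differentiable ('D_v f) x ->
  'D_v ('D_u f) x = 'D_u ('D_v f) x.
Proof.
move=> fd du dv; apply/eqP; rewrite -subr_eq0 -normr_le0.
apply/ler_addgt0Pr => e e0; rewrite add0r.
have e2 : 0 < e / 2 by rewrite divr_gt0.
have [a a0 Ha] := second_difference v fd du e2.
have [b b0 Hb] := second_difference u fd dv e2.
pose t := Num.min a b / 2.
have ab0 : 0 < Num.min a b by rewrite lt_min a0 b0.
have t0 : 0 < t by rewrite divr_gt0.
have tab : t < Num.min a b by rewrite /t ltr_pdivrMr // mulr_natr mulr2n ltrDl.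
move: tab; rewrite lt_min => /andP[ta tb].
have := Ha t; rewrite t0 ta => /(_ isT).
have := Hb t; rewrite t0 tb => /(_ isT).
rewrite [t *: v + (t *: u + x)]addrCA.
set X := f (t *: u + (t *: v + x)); set Y := f (t *: v + x).
set Z := f (t *: u + x); set P := 'D_v _ x; set Q := 'D_u _ x => H1 H2.
have t2 : 0 < t ^+ 2 by rewrite exprn_gt0.
rewrite -(ler_pM2l t2) -[X in X * `|_|](ger0_norm (ltW t2)) -normrM.
have -> : t ^+ 2 * (P - Q) = (X - Z - (Y - f x) - t ^+ 2 * Q)
   - (X - Y - (Z - f x) - t ^+ 2 * P) by ring.
have -> : t ^+ 2 * e = e / 2 * t ^+ 2 + e / 2 * t ^+ 2 by field.
exact: le_trans (ler_normB _ _) (lerD H1 H2).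
Qed.

Lemma derive_swap n (f : V -> 'rV[R]_n) (x u v : V) :
  (\forall y \near x, differentiable f y) ->
  differentiable ('D_u f) x -> differentiable ('D_v f) x ->
  'D_v ('D_u f) x = 'D_u ('D_v f) x.
Proof.
move=> fd du dv; apply/rowP => i.
have near_coord w : \forall y \near x,
    'D_w f y 0 i = 'D_w (fun z => f z 0 i : R^o) y.
  by apply: filterS fd => y dy; rewrite derive_coord.
have dc w : differentiable ('D_w f) x ->
    differentiable ('D_w (fun z => f z 0 i : R^o)) x.
  move=> dw; apply: near_eq_differentiable (near_coord w) _.
  by move/differentiable_mxP: dw; apply.
have E w w' : differentiable ('D_w f) x ->
    ('D_w' ('D_w f) x) 0 i = 'D_w' ('D_w (fun z => f z 0 i : R^o)) x.
  move=> dw; transitivity ('D_w' (fun y => 'D_w f y 0 i : R^o) x).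
    by symmetry; exact: derive_coord.
  exact: near_eq_derive (near_coord w).
apply: etrans (E u v du) _; apply: etrans _ (esym (E v u dv)).
apply: (@derive_swap_scalar (fun z => f z 0 i : R^o)); last 2 first.
- exact: dc.
- exact: dc.
by apply: filterS fd => y /differentiable_mxP; apply.
Qed.
End Young.

(** * Smooth functions and their composition *)

Section Smooth.
Context {R : realType}.

(** Bounding the order turns the quantification over lists in [smooth_on] into a predicate suited to
    induction. The count is shifted by one: [Ck 0] already asks for differentiability. *)
Fixpoint Ck (V W : normedModType R) (k : nat) (U : set V) (f : V -> W) : Prop :=
  (forall x, U x -> differentiable f x) /\
  if k is k'.+1 then forall v, Ck k' U ('D_v f) else True.

(** The head of the list is the derivative taken last, whereas [Ck] peels off the one taken first;
    hence both inductions work at the end of the list. *)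
Lemma smooth_onP (V W : normedModType R) (U : set V) (f : V -> W) :
  smooth_on U f <-> forall k, Ck k U f.
Proof.
split=> [sf k|sf s x Ux].
  have : forall s x, U x -> differentiable (foldr (fun v g => 'D_v g) f s) x by [].
  elim: k f {sf} => [|k IH] f sf; split=> //; first exact: (sf [::]).
    exact: (sf [::]).
  move=> v.
  by apply: IH => s x Ux; have := sf (rcons s v) x Ux; rewrite foldr_rcons.
have {sf} : Ck (size s) U f by exact: sf.
elim/last_ind: s f => [|s v IH] f; first by case=> /(_ _ Ux).
by rewrite size_rcons foldr_rcons => -[_ /(_ v)]; exact: IH.
Qed.

Lemma CkW (V W : normedModType R) k (U : set V) (f : V -> W) :
  Ck k.+1 U f -> Ck k U f.
Proof.
elim: k f => [|k IH] f [df dDf]; split=> // v.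
by apply: IH; exact: dDf.
Qed.

Lemma Ck_eq (V W : normedModType R) k (U : set V) (f g : V -> W) :
  open U -> (forall x, U x -> f x = g x) -> Ck k U f -> Ck k U g.
Proof.
move=> oU; elim: k f g => [|k IH] f g fg [df dDf].
  split=> // x Ux; apply: near_eq_differentiable (df x Ux).
  by near do apply: fg; exact: open_nbhs_nbhs.
have nfg x : U x -> \forall y \near x, f y = g y.
  move=> Ux; have : nbhs x U by exact: open_nbhs_nbhs.
  by apply: filterS => y; exact: fg.
split=> [x Ux|v]; first exact: near_eq_differentiable (nfg x Ux) (df x Ux).
by apply: IH (dDf v) => x Ux; exact: near_eq_derive (nfg x Ux).
Unshelve. all: by end_near. Qed.

Lemma Ck_sum (V W : normedModType R) k (U : set V) n (f : 'I_n -> V -> W) :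
  open U -> (forall i, Ck k U (f i)) -> Ck k U (\sum_i f i).
Proof.
move=> oU; elim: k f => [|k IH] f Cf; split=> //.
- by move=> x Ux; apply: differentiable_sum => i; have [/(_ _ Ux)] := Cf i.
- by move=> x Ux; apply: differentiable_sum => i; have [/(_ _ Ux)] := Cf i.
move=> v; apply: (@Ck_eq _ _ _ _ (\sum_i 'D_v (f i))) => // [x Ux|]; last first.
  by apply: IH => i; have [_ /(_ v)] := Cf i.
rewrite derive_sum ?fct_sumE// => i.
by apply: diff_derivable; have [/(_ _ Ux)] := Cf i.
Qed.

Lemma CkD (V W : normedModType R) k (U : set V) (f g : V -> W) :
  open U -> Ck k U f -> Ck k U g -> Ck k U (f + g).
Proof.
move=> oU Cf Cg; rewrite -[f + g](_ : \sum_(i < 2) nth 0 [:: f; g] i = _); last first.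
  by rewrite !big_ord_recl big_ord0 addr0.
by apply: Ck_sum => // -[[|[|]]].
Qed.

Lemma CkM (V : normedModType R) k (U : set V) (a f : V -> R^o) :
  open U -> Ck k U a -> Ck k U f -> Ck k U (fun y => a y * f y : R^o).
Proof.
move=> oU; elim: k a f => [|k IH] a f Ca Cf; split=> //.
- by move=> x Ux; apply: differentiableM; [exact: Ca.1|exact: Cf.1].
- by move=> x Ux; apply: differentiableM; [exact: Ca.1|exact: Cf.1].
move=> v; apply: (@Ck_eq _ _ _ _ ((fun y => a y * 'D_v f y) + (fun y => f y * 'D_v a y))) => //.
  by move=> x Ux; rewrite deriveM //; apply: diff_derivable; [exact: Ca.1|exact: Cf.1].
by apply: CkD => //; apply: IH; [exact: CkW|exact: Cf.2|exact: CkW|exact: Ca.2].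
Qed.

Lemma Ck_rowP (V : normedModType R) k (U : set V) n (f : V -> 'rV[R]_n) :
  open U -> Ck k U f <-> forall i, Ck k U (fun y => f y 0 i : R^o).
Proof.
move=> oU; have dP x : (forall i, differentiable (fun y => f y 0 i : R^o) x) ->
    differentiable f x.
  by move=> df; apply/differentiable_mxP => i j; rewrite ord1.
elim: k f dP => [|k IH] f dP.
  split=> [[df _] i|Cf]; split=> // x Ux.
    by have /differentiable_mxP := df x Ux; apply.
  by apply: dP => i; exact: (Cf i).1.
split=> [[df Df] i|Cf].
  split=> [x Ux|v]; first by have /differentiable_mxP := df x Ux; apply.
  apply: (@Ck_eq _ _ _ _ (fun y => 'D_v f y 0 i : R^o)) => // [x Ux|].
    by symmetry; apply: derive_coord; exact: df.
  apply: ((IH ('D_v f) _).1 (Df v)) => x dDf; apply/differentiable_mxP => a j; rewrite ord1.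
  exact: dDf.
have df x : U x -> differentiable f x.
  by move=> Ux; apply: dP => i; exact: (Cf i).1.
split=> // v; apply: (IH _ _).2 => [x dDf|i].
  by apply/differentiable_mxP => a j; rewrite ord1; exact: dDf.
apply: Ck_eq ((Cf i).2 v) => // x Ux; apply: derive_coord; exact: df.
Qed.

(** By the chain rule the derivative is a finite sum of products of components of the derivative of
    [s] with partial derivatives of [h] composed with [s], to which the induction hypothesis
    applies. *)
Lemma Ck_comp (V : normedModType R) n k (U : set V) (U' : set 'rV[R]_n)
    (s : V -> 'rV[R]_n) (h : 'rV[R]_n -> R^o) :
  open U -> (forall x, U x -> U' (s x)) -> Ck k U s -> Ck k U' h ->
  Ck k U (h \o s).
Proof.
move=> oU sU; elim: k h => [|k IH] h Cs Ch; split=> //.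
- by move=> x Ux; apply: differentiable_comp; [exact: Cs.1|apply: Ch.1; exact: sU].
- by move=> x Ux; apply: differentiable_comp; [exact: Cs.1|apply: Ch.1; exact: sU].
move=> v; apply: (@Ck_eq _ _ _ _ (\sum_i (fun y => 'D_v s y 0 i * 'D_(delta_mx 0 i) h (s y)))) => //.
  move=> x Ux; have dh : differentiable h (s x) by apply: Ch.1; exact: sU.
  rewrite fct_sumE (@derive_comp _ _ _ _ s h) //; last exact: Cs.1.
  by rewrite [RHS]derive_rowE.
apply: Ck_sum => // i; apply: CkM => //.
  by apply: (Ck_rowP _ _ _).1 => //; exact: Cs.2.
by apply: (IH ('D_(delta_mx 0 i) h)); [exact: CkW|exact: Ch.2].
Qed.

Lemma smooth_on_comp (V : normedModType R) n p (U : set V) (U' : set 'rV[R]_n)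
    (s : V -> 'rV[R]_n) (h : 'rV[R]_n -> 'rV[R]_p) :
  open U -> (forall x, U x -> U' (s x)) -> open U' ->
  smooth_on U s -> smooth_on U' h -> smooth_on U (h \o s).
Proof.
move=> oU sU oU' /smooth_onP Cs /smooth_onP Ch; apply/smooth_onP => k.
apply/Ck_rowP => // i.
apply: (@Ck_comp _ _ _ _ _ s (fun y => h y 0 i : R^o)) => //.
exact: sU.
by have := (Ck_rowP k h oU').1 (Ch k); apply.
Qed.

Lemma smooth_on_derive (V W : normedModType R) (U : set V) (f : V -> W) v :
  smooth_on U f -> smooth_on U ('D_v f).
Proof. by move=> /smooth_onP Cf; apply/smooth_onP => k; have [_ /(_ v)] := Cf k.+1. Qed.

Lemma smooth_on_eq (V W : normedModType R) (U : set V) (f g : V -> W) :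
  open U -> (forall x, U x -> f x = g x) -> smooth_on U f -> smooth_on U g.
Proof.
by move=> oU fg /smooth_onP Cf; apply/smooth_onP => k; exact: Ck_eq fg (Cf k).
Qed.

Lemma smooth_on_differentiable (V W : normedModType R) (U : set V) (f : V -> W) x :
  smooth_on U f -> U x -> differentiable f x.
Proof. by move=> sf Ux; exact: (sf [::]). Qed.

End Smooth.

(** * Charts, Jacobians and transition matrices *)

Section Charts.
Context {R : realType}.

(* The part of [smooth_manifold] that is needed; transition maps are only
   required to be differentiable, a condition that products inherit at once. *)
Definition atlas n (M : charted_space R n) : Prop :=
  (forall p : M,
    [/\ chart_dom p p, open (chart_dom p) & open (chart_img p)] /\
    [/\ forall x, chart_dom p x -> param p (chart p x) = x,
        forall x, chart_dom p x -> {for x, continuous (chart p)}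
      & forall y, chart_img p y -> {for y, continuous (param p)}]) /\
  forall (p q : M) y, chart_img p y -> chart_dom q (param p y) ->
    differentiable (chart q \o param p) y.

Definition C1_map m n (M : charted_space R m) (N : charted_space R n)
    (F : M -> N) : Prop :=
  continuous F /\
  forall (p : M) (q : N) y, chart_img p y -> chart_dom q (F (param p y)) ->
    differentiable (chart q \o F \o param p) y.

(** The second fundamental form sees two derivatives of a map in charts, and this much regularity
    passes easily to slices. *)
Definition C2_map m n (M : charted_space R m) (N : charted_space R n)
    (F : M -> N) : Prop :=
  C1_map F /\
  forall (p : M) (q : N) y v, chart_img p y -> chart_dom q (F (param p y)) ->
    differentiable ('D_v (chart q \o F \o param p)) y.

Lemma smooth_manifold_atlas n (M : charted_space R n) :
  smooth_manifold M -> atlas M.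
Proof.
move=> [_ _ chM trM]; split=> // p q y py qy.
by apply: smooth_on_differentiable (trM p q) _.
Qed.

Lemma smooth_map_C2 m n (M : charted_space R m) (N : charted_space R n)
  (F : M -> N) : smooth_map F -> C2_map F.
Proof.
move=> [cF sF]; split; first split=> // p q y py qy.
  by apply: smooth_on_differentiable (sF p q) _.
move=> p q y v py qy.
by apply: smooth_on_differentiable (smooth_on_derive v (sF p q)) _.
Qed.

Lemma mulmx_row_inj m n (A B : 'M[R]_(m, n)) :
  (forall u : 'rV[R]_m, u *m A = u *m B) -> A = B.
Proof. by move=> AB; apply/row_matrixP => i; rewrite !rowE AB. Qed.

Section OneSpace.
Context {n : nat} {M : charted_space R n}.
Hypothesis aM : atlas M.
Implicit Types p q r x z : M.

Lemma chart_dom_refl p : chart_dom p p.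
Proof. by have [[]] := aM.1 p. Qed.

Lemma chartK p z : chart_dom p z -> param p (chart p z) = z.
Proof. by have [_ [H _ _]] := aM.1 p; exact: H. Qed.

Lemma chart_img_chart p z : chart_dom p z -> chart_img p (chart p z).
Proof. by exists z. Qed.

Lemma chart_dom_param p y : chart_img p y -> chart_dom p (param p y).
Proof. by move=> [z pz <-]; rewrite chartK. Qed.

Lemma paramK p y : chart_img p y -> chart p (param p y) = y.
Proof. by move=> [z pz <-]; rewrite chartK. Qed.

Lemma near_param p y (U : set M) : chart_img p y -> nbhs (param p y) U ->
  \forall y' \near y, chart_img p y' /\ U (param p y').
Proof.
move=> py Uy; have [[_ _ oI] [_ _ cp]] := aM.1 p.
have : nbhs y (chart_img p) by exact: open_nbhs_nbhs.
have : nbhs y (param p @^-1` U) by exact: (cp y py).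
by apply: filterS2.
Qed.

Lemma near_dom p z : chart_dom p z -> nbhs z (chart_dom p).
Proof. by have [[_ oD _] _] := aM.1 p => pz; exact: open_nbhs_nbhs. Qed.

Lemma C1_idfun : C1_map (idfun : M -> M).
Proof.
split; first by move=> z; exact: cvg_id.
by move=> p q y; exact: aM.2.
Qed.

Lemma trans_refl p z : chart_dom p z -> trans p p z = 1%:M.
Proof.
move=> pz; apply: mulmx_row_inj => u; rewrite mulmx1 /trans.
have py : chart_img p (chart p z) by exact: chart_img_chart.
rewrite -deriveEjacobian; last first.
  by apply: aM.2 => //; rewrite chartK.
have E : \forall y \near chart p z, (chart p \o param p) y = id y.
  apply: filterS (near_param py _) => [y [py' _]|]; first exact: paramK.
  exact: filterT.
by rewrite (near_eq_derive _ E) derive_id.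
Qed.

End OneSpace.

Section OneMap.
Context {m n : nat} {M : charted_space R m} {N : charted_space R n}.
Hypotheses (aM : atlas M) (aN : atlas N).
Variable F : M -> N.
Hypothesis cF : C1_map F.
Implicit Types (p x z : M) (q : N).

Definition map_in p q : 'rV[R]_m -> 'rV[R]_n := chart q \o F \o param p.

Lemma near_map_in p q y : chart_img p y -> chart_dom q (F (param p y)) ->
  \forall y' \near y, chart_img p y' /\ chart_dom q (F (param p y')).
Proof.
move=> py qy; apply: (near_param aM py (U := F @^-1` chart_dom q)).
exact/(cF.1)/near_dom.
Qed.

Lemma map_in_differentiable p q y : chart_img p y ->
  chart_dom q (F (param p y)) -> differentiable (map_in p q) y.
Proof. exact: cF.2. Qed.

(** Chain rule for the factorization of [map_in p q] through the charts p' and q'. The factorization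
    holds only where all charts overlap, so it is used as an equality near the point. *)
Lemma jacobian_change p p' q q' z :
  chart_dom p z -> chart_dom p' z -> chart_dom q (F z) -> chart_dom q' (F z) ->
  jacobian (map_in p q) (chart p z) =
  trans p p' z *m jacobian (map_in p' q') (chart p' z) *m trans q' q (F z).
Proof.
move=> pz p'z qz q'z; apply: mulmx_row_inj => u.
have py := chart_img_chart pz; have p'y := chart_img_chart p'z.
have zK := chartK aM pz; have zK' := chartK aM p'z.
have FzK' := chartK aN q'z.
have d1 : differentiable (chart p' \o param p) (chart p z).
  by apply: aM.2 => //; rewrite zK.
have E1 : (chart p' \o param p) (chart p z) = chart p' z by rewrite /= zK.
have d2 : differentiable (map_in p' q') ((chart p' \o param p) (chart p z)).
  by rewrite E1; apply: map_in_differentiable => //; rewrite zK'.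
have E2 : map_in p' q' (chart p' z) = chart q' (F z) by rewrite /map_in /= zK'.
have d3 : differentiable (chart q \o param q') (map_in p' q' ((chart p' \o param p) (chart p z))).
  rewrite E1 E2; apply: aN.2; first exact: chart_img_chart.
  by rewrite FzK'.
have d21 := differentiable_comp d1 d2.
rewrite !mulmxA /trans -[u *m _]deriveEjacobian//; last first.
  by apply: map_in_differentiable => //; rewrite zK.
rewrite -[u *m _]deriveEjacobian//.
rewrite -E1 -[_ *m jacobian (map_in p' q') _]deriveEjacobian//.
rewrite -(@derive_comp _ _ _ _ (chart p' \o param p) (map_in p' q'))//.
rewrite -E2 -E1 -deriveEjacobian//.
rewrite -(@derive_comp _ _ _ _ (map_in p' q' \o (chart p' \o param p)) (chart q \o param q'))//.
apply: near_eq_derive.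
have nb : nbhs (param p (chart p z)) (chart_dom p' `&` F @^-1` chart_dom q').
  rewrite zK; apply: filterI; first exact: near_dom.
  exact/(cF.1)/near_dom.
apply: filterS (near_param aM py nb) => y [_ [p'y' q'y]].
by rewrite /map_in /= !chartK.
Qed.

Lemma derive_map_in p q y u : chart_img p y -> chart_dom q (F (param p y)) ->
  'D_u (map_in p q) y = u *m jacobian (map_in p q) y.
Proof. by move=> py qy; rewrite deriveEjacobian//; exact: map_in_differentiable. Qed.

End OneMap.

Section Transitions.
Context {n : nat} {M : charted_space R n}.
Hypothesis aM : atlas M.
Implicit Types p q r x z : M.

(** A transition matrix is the Jacobian of the identity map, so this is an instance of
    [jacobian_change]. *)
Lemma trans_mul p q r z : chart_dom p z -> chart_dom q z -> chart_dom r z ->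
  trans p q z *m trans q r z = trans p r z.
Proof.
move=> pz qz rz.
have := jacobian_change aM aM (C1_idfun aM) pz qz rz qz.
by rewrite -/(trans p r z) -/(trans q q z) trans_refl// mulmx1.
Qed.

Lemma trans_inv p q z : chart_dom p z -> chart_dom q z ->
  trans p q z *m trans q p z = 1%:M.
Proof. by move=> pz qz; rewrite trans_mul// trans_refl. Qed.

Lemma coord_field_in x u y : chart_img x y ->
  field_in idfun (coord_field x u) x x y = u.
Proof.
move=> xy; rewrite /field_in /coord_field -mulmxA trans_inv ?mulmx1//.
  exact: chart_dom_param.
exact: chart_dom_refl.
Qed.

Lemma metric_in_center (g : M -> 'M[R]_n) x : metric_in g x (chart x x) = g x.
Proof.
have xx := chart_dom_refl aM x.
by rewrite /metric_in chartK// trans_refl// mul1mx trmx1 mulmx1.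
Qed.

End Transitions.
End Charts.

(** * Inner products given by Gram matrices *)

Section InnerProduct.
Context {R : realType} {n : nat}.
Implicit Types (G : 'M[R]_n) (u v w : 'rV[R]_n).

Lemma ipDl G u v w : ip G (u + v) w = ip G u w + ip G v w.
Proof. by rewrite /ip !mulmxDl mxE. Qed.

Lemma ipDr G u v w : ip G u (v + w) = ip G u v + ip G u w.
Proof. by rewrite /ip linearD /= mulmxDr mxE. Qed.

Lemma ipNl G u v : ip G (- u) v = - ip G u v.
Proof. by rewrite /ip !mulNmx mxE. Qed.

Lemma ipNr G u v : ip G u (- v) = - ip G u v.
Proof. by rewrite /ip linearN /= mulmxN mxE. Qed.

Lemma ipBl G u v w : ip G (u - v) w = ip G u w - ip G v w.
Proof. by rewrite ipDl ipNl. Qed.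

Lemma ipBr G u v w : ip G u (v - w) = ip G u v - ip G u w.
Proof. by rewrite ipDr ipNr. Qed.

Lemma ipZl G a u v : ip G (a *: u) v = a * ip G u v.
Proof. by rewrite /ip -!scalemxAl mxE. Qed.

Lemma ipZr G a u v : ip G u (a *: v) = a * ip G u v.
Proof. by rewrite /ip linearZ /= -scalemxAr mxE. Qed.

Lemma ip0l G v : ip G 0 v = 0.
Proof. by rewrite /ip !mul0mx mxE. Qed.

Lemma ip0r G v : ip G v 0 = 0.
Proof. by rewrite /ip trmx0 mulmx0 mxE. Qed.

Lemma ip_trmx G u v : ip G^T u v = ip G v u.
Proof.
rewrite /ip; have -> : u *m G^T *m v^T = (v *m G *m u^T)^T.
  by rewrite !trmx_mul trmxK mulmxA.
by rewrite mxE.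
Qed.

Lemma ip_sym G u v : G^T = G -> ip G u v = ip G v u.
Proof. by move=> {1}<-; rewrite ip_trmx. Qed.

Lemma ip_delta G i j : ip G (delta_mx 0 i) (delta_mx 0 j) = G i j.
Proof. by rewrite /ip -rowE trmx_delta -colE !mxE. Qed.

Lemma ipE G u v : ip G u v = \sum_i \sum_j u 0 i * G i j * v 0 j.
Proof.
rewrite /ip mxE exchange_big; apply: eq_bigr => j _ /=.
by rewrite mxE mulr_suml; apply: eq_bigr => i _; rewrite !mxE.
Qed.

Lemma ip_inj G u v : G \in unitmx -> (forall w, ip G u w = ip G v w) -> u = v.
Proof.
move=> Gu uv; apply: (can_inj (mulmxK Gu)); apply/rowP => j.
by have := uv (delta_mx 0 j); rewrite /ip trmx_delta -!colE !mxE.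
Qed.

Lemma posdef_unit G : (forall v, v != 0 -> 0 < ip G v v) -> G \in unitmx.
Proof.
move=> Gp; rewrite unitmxE unitfE; apply/negP => /det0P[v v0 vG].
by have := Gp _ v0; rewrite /ip vG mul0mx mxE ltxx.
Qed.

End InnerProduct.

Lemma ip_mulmx (R : realType) m n (G : 'M[R]_n) (T : 'M[R]_(m, n)) u v :
  ip G (u *m T) (v *m T) = ip (T *m G *m T^T) u v.
Proof. by rewrite /ip trmx_mul !mulmxA. Qed.

Section DeriveIp.
Context {R : realType} {V : normedModType R} {n : nat}.
Implicit Types (A : V -> 'M[R]_n) (b c : V -> 'rV[R]_n) (x v : V).

Lemma differentiable_ip A b c x :
  differentiable A x -> differentiable b x -> differentiable c x ->
  differentiable (fun y => ip (A y) (b y) (c y) : R^o) x.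
Proof.
move=> dA db dc.
have /differentiable_mxP : differentiable (fun y => b y *m A y *m (c y)^T) x.
  apply: differentiable_mulmx; first exact: differentiable_mulmx.
  exact: differentiable_trmx.
exact.
Qed.

Lemma derive_ip A b c x v :
  differentiable A x -> differentiable b x -> differentiable c x ->
  'D_v (fun y => ip (A y) (b y) (c y) : R^o) x =
  ip ('D_v A x) (b x) (c x) + ip (A x) ('D_v b x) (c x)
  + ip (A x) (b x) ('D_v c x).
Proof.
move=> dA db dc.
have dbA := differentiable_mulmx db dA; have dct := differentiable_trmx dc.
transitivity (('D_v (fun y => b y *m A y *m (c y)^T) x) 0 0).
  exact: derive_coord (differentiable_mulmx dbA dct).
rewrite derive_mulmx// derive_mulmx// derive_trmx// mulmxDl.
by rewrite !mxE addrAC addrC addrA /ip !mxE; congr (_ + _); rewrite addrC.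
Qed.

Lemma derive_ip_const A x v (b c : 'rV[R]_n) : differentiable A x ->
  'D_v (fun y => ip (A y) b c : R^o) x = ip ('D_v A x) b c.
Proof.
move=> dA; rewrite derive_ip//; try exact: differentiable_cst.
by rewrite !derive_cst ip0l ip0r !addr0.
Qed.

End DeriveIp.

(** * The Levi-Civita connection in a chart *)

Lemma sum_rotate (V : nmodType) (I : finType) (F : I -> I -> I -> V) :
  \sum_i \sum_j \sum_k F i j k = \sum_k \sum_i \sum_j F i j k.
Proof.
under eq_bigr do rewrite exchange_big /=.
by rewrite exchange_big.
Qed.

Lemma sum_reverse (V : nmodType) (I : finType) (F : I -> I -> I -> V) :
  \sum_i \sum_j \sum_k F i j k = \sum_k \sum_j \sum_i F i j k.
Proof. by rewrite sum_rotate; apply: eq_bigr => k _; rewrite exchange_big. Qed.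

Section Christoffel.
Context {R : realType} {n : nat} {M : charted_space R n}.
Variables (g : M -> 'M[R]_n) (p : M) (y : 'rV[R]_n).
Let G := metric_in g p.
Hypotheses (dG : differentiable G y) (Gu : G y \in unitmx).
Hypothesis gsym : forall x, (g x)^T = g x.

Lemma metric_in_sym z : (G z)^T = G z.
Proof. by rewrite /G /metric_in !trmx_mul trmxK gsym mulmxA. Qed.

Lemma derive_metric_sym u : ('D_u G y)^T = 'D_u G y.
Proof.
rewrite -derive_trmx//; congr ('D_u _ y).
by apply/funext => z; exact: metric_in_sym.
Qed.

(** Koszul formula for coordinate fields: pairing with the metric cancels the inverse Gram matrix in
    [christoffel] and leaves the symbols of the first kind. *)
Lemma ip_christoffel u v w :
  ip (G y) (christoffel g p y u v) w =
  2^-1 * (ip ('D_u G y) v w + ip ('D_v G y) u w - ip ('D_w G y) u v).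
Proof.
pose d (l i j : 'I_n) := ('D_(delta_mx 0 l) G y) i j.
(* [c] is [christoffel g p y u v] with its index lowered. *)
pose c : 'rV[R]_n := \row_l \sum_i \sum_j
  (2^-1 * (d i j l + d j i l - d l i j) * u 0 i * v 0 j).
have invS k l : invmx (G y) k l = invmx (G y) l k.
  by rewrite -[in LHS](metric_in_sym y) -trmx_inv mxE.
have -> : christoffel g p y u v = c *m invmx (G y).
  apply/rowP => k; rewrite !mxE.
  under [RHS]eq_bigr do rewrite mxE mulr_suml.
  rewrite [RHS]exchange_big; apply: eq_bigr => i _ /=.
  under [RHS]eq_bigr do rewrite mulr_suml.
  rewrite [RHS]exchange_big; apply: eq_bigr => j _ /=.
  rewrite mulr_sumr !mulr_suml; apply: eq_bigr => l _ /=.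
  by rewrite /d -/G (invS k l); ring.
rewrite [LHS]/ip mulmxKV// mxE.
have E a b e : ip ('D_a G y) b e =
    \sum_l \sum_i \sum_j a 0 l * (b 0 i * d l i j * e 0 j).
  rewrite derive_rowE// ipE; under eq_bigr do under eq_bigr do rewrite summxE.
  under eq_bigr do under eq_bigr do rewrite mulr_sumr mulr_suml.
  under eq_bigr do rewrite exchange_big /=.
  rewrite exchange_big; apply: eq_bigr => l _ /=.
  apply: eq_bigr => i _; apply: eq_bigr => j _.
  by rewrite !mxE /d; ring.
move: (E u v w) (E v u w) (E w u v); clear E; clearbody d.
move: ('D_u G y) ('D_v G y) ('D_w G y) => A B C.
move=> E1 E2 E3.
(* Indices are renamed so that in all three sums the outer one belongs to w, the next to u and the
   inner one to v. *)
rewrite (etrans E1 (sum_rotate _)) (etrans E2 (sum_reverse _)) E3.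
rewrite -big_split -sumrB mulr_sumr; apply: eq_bigr => l _ /=.
rewrite !mxE mulr_suml -big_split -sumrB mulr_sumr; apply: eq_bigr => i _ /=.
rewrite mulr_suml -big_split -sumrB mulr_sumr; apply: eq_bigr => j _ /=.
ring.
Qed.

Lemma christoffel_sym u v : christoffel g p y u v = christoffel g p y v u.
Proof.
apply: (ip_inj Gu) => w; rewrite !ip_christoffel.
move: (derive_metric_sym w).
move: ('D_u G y) ('D_v G y) ('D_w G y) => A B C sC.
by rewrite (ip_sym v u sC) [ip A v w + _]addrC.
Qed.

(** In the sum of the two Koszul expressions the derivatives along v and w cancel, and the
    derivative along u occurs twice with factor 1/2. *)
Lemma metric_compatible u v w : ip ('D_u G y) v w =
  ip (G y) (christoffel g p y u v) w + ip (G y) v (christoffel g p y u w).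
Proof.
rewrite (ip_sym v _ (metric_in_sym y)) !ip_christoffel.
move: (derive_metric_sym u) (derive_metric_sym v) (derive_metric_sym w).
move: ('D_u G y) ('D_v G y) ('D_w G y) => A B C sA sB sC.
by rewrite (ip_sym w v sA); field.
Qed.

End Christoffel.

Lemma congruence_mul (R : comPzRingType) m n p q (A : 'M[R]_(m, n))
    (B : 'M[R]_(n, q)) (C : 'M[R]_(m, p)) (D : 'M[R]_(p, q)) (g : 'M[R]_q) :
  A *m B = C *m D ->
  A *m (B *m g *m B^T) *m A^T = C *m (D *m g *m D^T) *m C^T.
Proof.
move=> E; rewrite !mulmxA E -!mulmxA; congr (_ *m (_ *m (_ *m _))).
by rewrite -!trmx_mul E.
Qed.

Lemma christoffel_linear (R : realType) n (M : charted_space R n)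
    (g : M -> 'M[R]_n) p y v : linear (fun u => christoffel g p y u v).
Proof.
move=> a u u'; apply/rowP => k; rewrite !mxE mulr_sumr -big_split.
apply: eq_bigr => i _ /=; rewrite mulr_sumr -big_split; apply: eq_bigr => j _ /=.
by rewrite !mxE; ring.
Qed.

(** * Gauss formula and basic properties of the second fundamental form *)

Section SecondFundamentalForm.
Context {R : realType} {m n : nat}.
Context {M : charted_space R m} {N : charted_space R n}.
Hypotheses (aM : atlas M) (aN : atlas N).
Variables (g : N -> 'M[R]_n) (F : M -> N).
Hypotheses (cF : C2_map F) (gR : riemannian_metric g).
Variable x : M.
Let y0 := chart x x.
Let phi := map_in F x (F x).
Let T := tangent_map F x.
Let G := metric_in g (F x).

Let xx : chart_dom x x. Proof. exact: chart_dom_refl. Qed.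
Let Fxx : chart_dom (F x) (F x). Proof. exact: chart_dom_refl. Qed.
Let y0K : param x y0 = x. Proof. exact: chartK. Qed.
Let xy0 : chart_img x y0. Proof. exact: chart_img_chart. Qed.

Lemma near_center :
  \forall y \near y0, chart_img x y /\ chart_dom (F x) (F (param x y)).
Proof.
have Fy : chart_dom (F x) (F (param x y0)) by rewrite y0K.
exact: (near_map_in aM aN cF.1 xy0 Fy).
Qed.

Lemma map_center : phi y0 = chart (F x) (F x).
Proof. by rewrite /phi /map_in /= y0K. Qed.

Lemma center_differentiable : \forall y \near y0, differentiable phi y.
Proof. by apply: filterS near_center => y []; exact: (map_in_differentiable cF.1). Qed.

Lemma center_derive_differentiable v : differentiable ('D_v phi) y0.
Proof. by apply: cF.2 => //; rewrite y0K. Qed.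

Lemma derive_center u : 'D_u phi y0 = u *m T.
Proof. by apply: (derive_map_in cF.1) => //; rewrite y0K. Qed.

(** [pullback] at z refers to the charts at z and F z, which move with y. The transitions between
    these charts and the fixed ones cancel, and what is left can be differentiated in y. *)
Lemma metric_in_pullback y : chart_img x y -> chart_dom (F x) (F (param x y)) ->
  metric_in (pullback F g) x y =
  jacobian phi y *m G (phi y) *m (jacobian phi y)^T.
Proof.
move=> xy Fxy; set z := param x y.
have xz : chart_dom x z by exact: chart_dom_param.
have zz : chart_dom z z by exact: chart_dom_refl.
have Fzz : chart_dom (F z) (F z) by exact: chart_dom_refl.
have E : trans x z z *m tangent_map F z = jacobian phi y *m trans (F x) (F z) (F z).
  have yE : y = chart x z by rewrite paramK.
  rewrite yE (jacobian_change aM aN cF.1 xz zz Fxy Fzz) -!mulmxA.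
 by rewrite (trans_inv aN Fzz Fxy) mulmx1.
have FzE : param (F x) (phi y) = F z by rewrite /phi /map_in /= chartK.
have GE : G (phi y) = trans (F x) (F z) (F z) *m g (F z) *m (trans (F x) (F z) (F z))^T.
  by rewrite /G /metric_in FzE.
transitivity (trans x z z *m (tangent_map F z *m g (F z) *m (tangent_map F z)^T)
  *m (trans x z z)^T); first by [].
rewrite GE; exact: (congruence_mul (g (F z)) E).
Qed.

Lemma ip_pullback_in v w : \forall y \near y0,
  ip (metric_in (pullback F g) x y) v w =
  ip (G (phi y)) ('D_v phi y) ('D_w phi y).
Proof.
apply: filterS near_center => y [xy Fxy].
rewrite metric_in_pullback// -ip_mulmx.
by rewrite -!(derive_map_in cF.1).
Qed.

Let dG y : chart_img (F x) y -> differentiable G y.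
Proof. by move=> Gy; have [_ _ sg] := gR; exact: smooth_on_differentiable (sg _) Gy. Qed.

Let Gphi : differentiable G (phi y0).
Proof. by apply: dG; rewrite map_center; exact: chart_img_chart. Qed.

Lemma G_center : G (phi y0) = g (F x).
Proof. by rewrite map_center /G metric_in_center. Qed.

Let gsym z : (g z)^T = g z. Proof. by have [] := gR. Qed.

Let Gu : G (phi y0) \in unitmx.
Proof. by rewrite G_center; apply: posdef_unit => v; have [_ + _] := gR; apply. Qed.

Let dphi : differentiable phi y0.
Proof. exact: nbhs_singleton center_differentiable. Qed.

Let dGphi : differentiable (G \o phi) y0.
Proof. exact: differentiable_comp. Qed.

Lemma pullback_differentiable : differentiable (metric_in (pullback F g) x) y0.
Proof.
apply/differentiable_mxP => i j.
have := @differentiable_ip _ _ _ _ _ _ _ dGphi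
  (center_derive_differentiable (delta_mx 0 i)) (center_derive_differentiable (delta_mx 0 j)).
apply: near_eq_differentiable.
by apply: filterS (ip_pullback_in (delta_mx 0 i) (delta_mx 0 j)) => y <-; rewrite ip_delta.
Qed.

(* Ambient derivative of the field with constant components [v]: the second
   fundamental form together with its tangential part. *)
Definition ambient_sff (u v : 'rV[R]_m) : 'rV[R]_n :=
  'D_u ('D_v phi) y0 + christoffel g (F x) (chart (F x) (F x)) (u *m T) (v *m T).

(** Young's theorem for the second derivative, and vanishing torsion for the Christoffel term. *)
Lemma ambient_sff_sym u v : ambient_sff u v = ambient_sff v u.
Proof.
have E1 : 'D_u ('D_v phi) y0 = 'D_v ('D_u phi) y0.
  exact: (derive_swap center_differentiable (center_derive_differentiable v)
    (center_derive_differentiable u)).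
have E2 := christoffel_sym Gphi Gu gsym (u *m T) (v *m T).
rewrite map_center in E2.
exact: (f_equal2 +%R E1 E2).
Qed.

(** A coordinate field has constant components in the chart x, so its intrinsic covariant derivative
    reduces to a Christoffel term; pushed forward by F, its components near x are those of
    ['D_v phi]. *)
Lemma sffE u v : sff g F x u v =
  ambient_sff u v - christoffel (pullback F g) x y0 u v *m T.
Proof.
have near1 : \forall y \near y0, u = u -> field_in F
    (fun z => coord_field x v z *m tangent_map F z) x (F x) y = 'D_v phi y.
  apply: filterS near_center => y [xy Fxy] _.
  rewrite (derive_map_in cF.1)// /field_in /coord_field; set z := param x y.
  have yE : y = chart x z by rewrite paramK.
  have xz : chart_dom x z by exact: chart_dom_param.
  rewrite [in RHS]yE (jacobian_change aM aN cF.1 xz (chart_dom_refl aM z) Fxy (chart_dom_refl aN (F z))).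
  by rewrite !mulmxA.
have near2 : \forall y \near y0, field_in idfun (coord_field x v) x x y = cst v y.
  by apply: filterS near_center => y [xy _]; exact: coord_field_in.
have cx w : coord_field x w x = w by rewrite /coord_field trans_refl// mulmx1.
have tid : tangent_map (idfun : M -> M) x = 1%:M by exact: trans_refl.
have E1 : 'D_u (field_in F (fun z => coord_field x v z *m tangent_map F z) x (F x)) y0
    = 'D_u ('D_v phi) y0.
  by apply: near_eq_derive; apply: filterS near1 => y; apply.
have E2 : cov (pullback F g) idfun (coord_field x v) x u
    = christoffel (pullback F g) x y0 u v.
  have D0 : 'D_u (field_in idfun (coord_field x v) x x) y0 = 0.
    have := @near_eq_derive _ _ _ _ (cst v) y0 u near2.
    by rewrite derive_cst.
  rewrite /cov tid mulmx1 cx; apply: etrans (f_equal (+%R^~ _) D0) _.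
  exact: add0r.
rewrite /sff /sff_field !cx E2; apply: (f_equal (+%R^~ _)).
rewrite /cov cx; exact: (f_equal (+%R^~ _) E1).
Qed.

(** Product rule for g(D_v phi, D_w phi); compatibility of the ambient metric splits the derivative
    of [G] into the Christoffel terms that complete both second derivatives to [ambient_sff]. *)
Lemma derive_pullback u v w :
  ip ('D_u (metric_in (pullback F g) x) y0) v w =
  ip (g (F x)) (ambient_sff u v) (w *m T) + ip (g (F x)) (v *m T) (ambient_sff u w).
Proof.
apply: etrans (esym (derive_ip_const u v w pullback_differentiable)) _.
apply: etrans (near_eq_derive _ (ip_pullback_in v w)) _.
apply: etrans (derive_ip _ dGphi (center_derive_differentiable v) (center_derive_differentiable w)) _.
rewrite (derive_comp _ dphi Gphi) !derive_center /ambient_sff ipDl ipDr.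
rewrite (metric_compatible Gphi Gu gsym) -G_center -map_center /=.
rewrite -[LHS]addrA addrACA; exact: (f_equal2 +%R (addrC _ _) (addrC _ _)).
Qed.

Hypothesis pu : pullback F g x \in unitmx.

(** The Koszul formula of the induced metric, expanded by [derive_pullback], has six terms; by
    symmetry of [ambient_sff] four cancel in pairs and two agree. So the tangential part of the
    ambient derivative is the induced connection, which makes [sff] normal. *)
Lemma ambient_sff_tangent u v w :
  ip (g (F x)) (ambient_sff u v) (w *m T) =
  ip (pullback F g x) (christoffel (pullback F g) x y0 u v) w.
Proof.
have psym z : (pullback F g z)^T = pullback F g z.
  by rewrite /pullback !trmx_mul trmxK gsym mulmxA.
have pE : metric_in (pullback F g) x y0 = pullback F g x.
  by rewrite metric_in_center.
have pu0 : metric_in (pullback F g) x y0 \in unitmx by rewrite pE.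
have K := ip_christoffel pullback_differentiable pu0 psym u v w.
rewrite pE in K; apply: etrans _ (esym K) => {K}.
move: (derive_pullback u v w) (derive_pullback v u w) (derive_pullback w u v).
move: ('D_u _ _) ('D_v _ _) ('D_w _ _) => A B C -> -> ->.
rewrite (ambient_sff_sym v u) (ambient_sff_sym w u) (ambient_sff_sym w v).
move: (ambient_sff u v) (ambient_sff u w) (ambient_sff v w) => a b c.
by rewrite (ip_sym b (v *m T) (gsym _)); field.
Qed.

Lemma sff_normal u v w : ip (g (F x)) (sff g F x u v) (w *m T) = 0.
Proof. by rewrite sffE ipBl ambient_sff_tangent ip_mulmx subrr. Qed.

Lemma sff_sym u v : sff g F x u v = sff g F x v u.
Proof.
rewrite !sffE ambient_sff_sym; congr (_ - _ *m _).
apply: (christoffel_sym pullback_differentiable).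
  by rewrite metric_in_center.
by move=> z; rewrite /pullback !trmx_mul trmxK gsym mulmxA.
Qed.

Lemma sff_linear v : linear (fun u => sff g F x u v).
Proof.
move=> a u u'; rewrite !sffE /ambient_sff mulmxDl -scalemxAl.
rewrite !christoffel_linear mulmxDl -scalemxAl.
have D := derive_linear (center_derive_differentiable v) a u u'.
move: D; move: ('D_(a *: u + u') _ _) ('D_u _ _) ('D_u' _ _) => d1 d2 d3 -> {d1}.
by apply/rowP => j; rewrite !mxE; ring.
Qed.

End SecondFundamentalForm.

(** * Orthonormal frames and traces *)

Section Frames.
Context {R : realType}.

Lemma orthonormal_basis_exists n (G : 'M[R]_n) :
  G^T = G -> (forall v, v != 0 -> 0 < ip G v v) ->
  exists E, orthonormal_basis G E.
Proof.
elim: n G => [|n IH] G Gs Gp.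
  by exists 1%:M; rewrite /orthonormal_basis; apply/matrixP => -[].
move: G Gs Gp; rewrite -[n.+1]/(1 + n)%N => G Gs Gp.
pose e0 : 'rV[R]_(1 + n) := row_mx 1%:M 0.
pose a := ip G e0 e0.
have a0 : 0 < a.
  apply: Gp; apply/eqP => /(f_equal lsubmx); rewrite row_mxKl => /matrixP/(_ 0 0).
  by rewrite !mxE => /eqP; rewrite oner_eq0.
pose p : 'M[R]_(n, 1 + n) := row_mx 0 1%:M.
(* One Gram-Schmidt step: the rows of [q] are orthogonal to [e0]. *)
pose q : 'M[R]_(n, 1 + n) := p - a^-1 *: (p *m G *m e0^T *m e0).
have qe : q *m G *m e0^T = 0.
  rewrite !mulmxBl -!scalemxAl -!mulmxA.
  have -> : e0 *m (G *m e0^T) = a%:M by rewrite mulmxA [LHS]mx11_scalar.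
  by rewrite mul_mx_scalar -!scalemxAr scalerA mulVf ?gt_eqF// scale1r subrr.
have eq : e0 *m G *m q^T = 0.
  by apply: trmx_inj; rewrite !trmx_mul trmxK Gs mulmxA qe trmx0.
have [||E' EE'] := IH (q *m G *m q^T).
- by rewrite !trmx_mul trmxK Gs mulmxA.
- move=> v v0; rewrite -ip_mulmx; apply: Gp; apply: contra v0 => /eqP vq.
  apply/eqP; have /(f_equal rsubmx) := vq.
  rewrite /q mulmxBr /p /e0 mul_mx_row mulmx0 mulmx1 -scalemxAr.
  by rewrite !mul_mx_row !mulmx0 scale_row_mx scaler0 opp_row_mx oppr0 add_row_mx addr0 row_mxKr linear0.
exists (col_mx ((Num.sqrt a)^-1 *: e0) (E' *m q)).
rewrite /orthonormal_basis tr_col_mx mul_col_mx mul_col_row.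
have -> : (Num.sqrt a)^-1 *: e0 *m G *m ((Num.sqrt a)^-1 *: e0)^T = 1%:M.
  rewrite linearZ /= -!scalemxAl -!scalemxAr scalerA [_ *m _]mx11_scalar -/(ip G e0 e0).
  by rewrite scale_scalar_mx -invfM -expr2 sqr_sqrtr ?(ltW a0)// mulVf ?gt_eqF.
have -> : (Num.sqrt a)^-1 *: e0 *m G *m (E' *m q)^T = 0.
  by rewrite trmx_mul mulmxA -!scalemxAl eq mul0mx scaler0.
have -> : E' *m q *m G *m ((Num.sqrt a)^-1 *: e0)^T = 0.
  by rewrite linearZ /= -scalemxAr -!mulmxA [q *m _]mulmxA qe mulmx0 scaler0.
have -> : E' *m q *m G *m (E' *m q)^T = 1%:M.
  by rewrite trmx_mul !mulmxA -EE' !mulmxA.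
by rewrite -scalar_mx_block.
Qed.

Lemma orthonormal_basis_inv n (G E : 'M[R]_n) : G \in unitmx ->
  orthonormal_basis G E -> E^T *m E = invmx G.
Proof.
rewrite /orthonormal_basis => Gu /mulmx1C; rewrite mulmxA => EG.
by rewrite -[LHS](mulmxK Gu) EG mul1mx.
Qed.

Lemma orthonormal_basis_unit n (G E : 'M[R]_n) :
  orthonormal_basis G E -> E \in unitmx.
Proof. by rewrite /orthonormal_basis -mulmxA => /mulmx1_unit[]. Qed.

Lemma linear_rowE n k (L : 'rV[R]_n -> 'rV[R]_k) : linear L ->
  exists A : 'M[R]_(n, k), forall u, L u = u *m A.
Proof.
move=> lL.
pose LM := GRing.isLinear.Build _ _ _ _ _ lL.
pose L' : {linear 'rV[R]_n -> 'rV[R]_k} := HB.pack L LM.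
by exists (lin1_mx L') => u; rewrite mul_rV_lin1.
Qed.

(* Both sides are the trace of the form against the inverse of [S]. *)
Lemma frame_change n k (S E E' : 'M[R]_n) (G : 'M[R]_k) (L : 'rV[R]_n -> 'rV[R]_k) :
  S \in unitmx -> orthonormal_basis S E -> orthonormal_basis S E' -> linear L ->
  \sum_i ip G (L (row i E)) (L (row i E)) =
  \sum_i ip G (L (row i E')) (L (row i E')).
Proof.
move=> Su SE SE' /linear_rowE[A LA].
have tr (B : 'M[R]_n) : \sum_i ip G (L (row i B)) (L (row i B)) =
    \tr (A *m G *m A^T *m (B^T *m B)).
  rewrite [in RHS]mulmxA mxtrace_mulC [in RHS]mulmxA; apply: eq_bigr => i _.
  rewrite !LA ip_mulmx /ip -row_mul; move: (B *m _) => Y.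
  by rewrite [LHS]mxE [RHS]mxE; apply: eq_bigr => k0 _; rewrite !mxE.
by rewrite !tr (orthonormal_basis_inv Su SE) (orthonormal_basis_inv Su SE').
Qed.

Lemma linear_frame0 n k (S E : 'M[R]_n) (L : 'rV[R]_n -> 'rV[R]_k) :
  orthonormal_basis S E -> linear L -> (forall i, L (row i E) = 0) ->
  forall u, L u = 0.
Proof.
move=> /orthonormal_basis_unit Eu /linear_rowE[A LA] L0 u.
rewrite LA -[A]mul1mx -(mulVmx Eu) -mulmxA; have -> : E *m A = 0.
  by apply/row_matrixP => i; rewrite row_mul -LA L0 row0.
by rewrite !mulmx0.
Qed.

(** The sum is the squared Euclidean length of [d *m E^T], and [E^T *m E] is the inverse of [S]: it
    is the squared norm of the covector d in the dual metric, hence that of the gradient when d is a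
    differential. *)
Lemma sum_sqr_frame n (S E : 'M[R]_n) (d : 'rV[R]_n) : S \in unitmx ->
  orthonormal_basis S E ->
  \sum_i (row i E *m d^T) 0 0 ^+ 2 = ip (invmx S) d d.
Proof.
move=> Su SE; rewrite -(orthonormal_basis_inv Su SE) /ip.
rewrite mulmxA -mulmxA -[d]trmxK -trmx_mul trmxK mxE.
by apply: eq_bigr => i _; rewrite -row_mul !mxE expr2.
Qed.

End Frames.

Lemma row_full_orthogonal (R : realType) k l (B : 'M[R]_(l, k)) (G : 'M[R]_k)
    (u : 'rV[R]_k) : G \in unitmx -> row_full B -> u *m G *m B^T = 0 -> u = 0.
Proof.
move=> Gu /row_fullP[B' B'B] uGB.
have : u *m G = 0.
  by rewrite -[u *m G]mulmx1 -trmx1 -B'B trmx_mul mulmxA uGB mul0mx.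
by move/(f_equal (mulmxr (invmx G))) => /=; rewrite mulmxK// mul0mx.
Qed.

(** Polarization; it turns the slant condition, which concerns lengths of single vectors, into an
    identity of matrices. *)
Lemma quadratic_form_inj (R : realType) n (A B : 'M[R]_n) :
  A^T = A -> B^T = B -> (forall v, ip A v v = ip B v v) -> A = B.
Proof.
move=> As Bs AB; apply/matrixP => i j; rewrite -!ip_delta.
have := AB (delta_mx 0 i + delta_mx 0 j); rewrite !(ipDl, ipDr) !AB.
rewrite (ip_sym (delta_mx 0 j) _ As) (ip_sym (delta_mx 0 j) _ Bs); lra.
Qed.

(** * Linear algebra of a holomorphic and a slant subspace at a point *)

Section Pointwise.
Context {R : realType} {m n : nat}.
Local Notation N := (m + 2 * n)%N.
Variables (G J : 'M[R]_N) (C : 'M[R]_(m, N)) (A : 'M[R]_(n, N)).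
Variables (S1 : 'M[R]_m) (S2 : 'M[R]_n).
Hypotheses (Gs : G^T = G) (Gp : forall v, v != 0 -> 0 < ip G v v).
Hypotheses (JJ : J *m J = - 1%:M)
  (JG : forall u v, ip G (u *m J) (v *m J) = ip G u v).
Hypotheses (AGA : A *m G *m A^T = S2) (CGC : C *m G *m C^T = S1)
  (AGC : A *m G *m C^T = 0).
Hypothesis CJ : (C *m J <= C)%MS.
Variable th : R.
Hypothesis slant : forall X : 'rV[R]_n, X != 0 ->
  subspace_angle G (X *m A *m J) A th.
Hypothesis sth : sin th != 0.
Hypotheses (S1p : forall v, v != 0 -> 0 < ip S1 v v)
  (S2p : forall v, v != 0 -> 0 < ip S2 v v).

Let Gu : G \in unitmx. Proof. exact: posdef_unit. Qed.
Let S1u : S1 \in unitmx. Proof. exact: posdef_unit. Qed.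
Let S2u : S2 \in unitmx. Proof. exact: posdef_unit. Qed.

Let S1s : S1^T = S1. Proof. by rewrite -CGC !trmx_mul trmxK Gs mulmxA. Qed.
Let S2s : S2^T = S2. Proof. by rewrite -AGA !trmx_mul trmxK Gs mulmxA. Qed.

Let JGJ : J *m G *m J^T = G.
Proof.
by apply/matrixP => i j; rewrite -!ip_delta -ip_mulmx JG.
Qed.

Let JGE : J *m G = - (G *m J^T).
Proof.
rewrite -[in LHS]JGJ !mulmxA JJ mulNmx mul1mx.
by rewrite mulNmx.
Qed.

(** J on D^T, in the basis formed by the rows of [C]. The rows of [A] are a basis of D^theta. *)
Let P := C *m J *m pinvmx C.
Let CJE : C *m J = P *m C. Proof. by rewrite mulmxKpV. Qed.

Let K := A *m J *m G *m A^T.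
Let KT : K^T = - K.
Proof.
have -> : K^T = A *m (G *m J^T) *m A^T.
  by rewrite /K !trmx_mul trmxK Gs !mulmxA.
by rewrite /K -(mulmxA A J G) JGE mulmxN mulNmx opprK.
Qed.

(** J is skew and preserves D^T, so it keeps D^theta orthogonal to D^T. *)
Let AJGC : A *m J *m G *m C^T = 0.
Proof.
rewrite -(mulmxA A J G) JGE mulmxN mulNmx -!mulmxA -trmx_mul CJE trmx_mul.
by rewrite !mulmxA AGC mul0mx oppr0.
Qed.

(** The tangential part of J on D^theta: dividing by the Gram matrix turns the products g(JZ, W)
    collected in [K] into coordinates with respect to [A]. What remains of [A *m J] is the normal
    part [F]. *)
Let Th := K *m invmx S2.
Let F := A *m J - Th *m A.

Let ThS : Th *m S2 = K. Proof. by rewrite /Th mulmxKV. Qed.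

Let FGE l (B : 'M[R]_(N, l)) : F *m G *m B = A *m J *m G *m B - Th *m (A *m G *m B).
Proof. by rewrite /F; move: Th => X; rewrite !mulmxBl !mulmxA. Qed.

Let FGA : F *m G *m A^T = 0. Proof. by rewrite FGE AGA ThS subrr. Qed.

Let FGC : F *m G *m C^T = 0.
Proof. by rewrite FGE AJGC AGC mulmx0 subrr. Qed.

Let c2 := cos th ^+ 2.

(** The vector provided by [subspace_angle] is the orthogonal projection of JX, that is X [Th] in
    coordinates. Its length is cos(theta) times that of X, and polarization gives the matrix
    identity. *)
Let ThSTh : Th *m S2 *m Th^T = c2 *: S2.
Proof.
apply: quadratic_form_inj => [||X].
- by move: Th => X; rewrite !trmx_mul trmxK S2s mulmxA.
- by rewrite linearZ /= S2s.
rewrite -ip_mulmx.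
have [->|X0] := eqVneq X 0; first by rewrite mul0mx !ip0l.
have [_ [/submxP[w ->] orth thE]] := slant X0.
have XJ : X *m A *m J = X *m Th *m A + X *m F.
  by rewrite /F mulmxBr !mulmxA addrC subrK.
have FA a b : ip G (a *m F) (b *m A) = 0.
  by rewrite /ip trmx_mul -!mulmxA (mulmxA F) (mulmxA (F *m G)) FGA mul0mx mulmx0 mxE.
have wE : w = X *m Th.
  apply: (ip_inj S2u) => b; rewrite -AGA -!ip_mulmx.
  have := orth (b *m A) (submxMl _ _); rewrite ipBl => /eqP; rewrite subr_eq0 => /eqP <-.
  by rewrite XJ ipDl FA addr0.
have AA a b : ip G (a *m A) (b *m A) = ip S2 a b by rewrite ip_mulmx AGA.
have XX : ip G (X *m A *m J) (X *m A *m J) = ip S2 X X by rewrite JG AA.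
have Xp : 0 < ip S2 X X by exact: S2p.
have G0 v : 0 <= ip G v v.
  by have [->|/Gp/ltW//] := eqVneq v 0; rewrite ip0l.
have le : ip S2 w w <= ip S2 X X.
  rewrite -XX XJ -wE ipDl !ipDr FA (ip_sym _ (X *m F) Gs) FA addr0 add0r AA.
  by rewrite lerDl.
have w0 : 0 <= ip S2 w w by rewrite -AA.
(* [acosK] needs the quotient of lengths to lie in [-1, 1]; it does because projection does not
   lengthen and J is an isometry. *)
have cE : cos th = Num.sqrt (ip S2 w w) / Num.sqrt (ip S2 X X).
  rewrite thE /tnorm AA XX acosK// in_itv /=; apply/andP; split.
    by apply: le_trans (divr_ge0 (sqrtr_ge0 _) (sqrtr_ge0 _)); rewrite lerN10.
  by rewrite ler_pdivrMr ?sqrtr_gt0// mul1r ler_wsqrtr.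
have -> : ip (c2 *: S2) X X = c2 * ip S2 X X.
  by rewrite /ip -scalemxAr -scalemxAl mxE.
rewrite /c2 cE expr_div_n !sqr_sqrtr// ?(ltW Xp)// divfK ?gt_eqF//.
by rewrite wE ip_mulmx.
Qed.

Let s2 := sin th ^+ 2.
Let s2p : 0 < s2. Proof. by rewrite exprn_even_gt0. Qed.

(** J is an isometry, so removing the tangential share cos^2 leaves 1 - cos^2 for the normal
    part. *)
Let FGF : F *m G *m F^T = s2 *: S2.
Proof.
have AGF : A *m G *m F^T = 0.
  by apply: trmx_inj; rewrite !trmx_mul trmxK Gs mulmxA FGA trmx0.
rewrite {1}/F !mulmxBl -(mulmxA Th) -(mulmxA Th) AGF mulmx0 subr0.
rewrite /F [(_ - _)^T]linearB /= mulmxBr.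
have -> : A *m J *m G *m (A *m J)^T = S2.
  by rewrite trmx_mul -AGA -[in RHS]JGJ !mulmxA.
have -> : A *m J *m G *m (Th *m A)^T = K *m Th^T.
  by move: Th => X; rewrite trmx_mul mulmxA.
rewrite -ThS ThSTh /s2 -[sin th ^+ 2](addKr c2) /c2 cos2Dsin2.
by rewrite scalerDl scale1r scaleNr addrC.
Qed.

(** The three blocks are mutually orthogonal with invertible Gram matrices, the last one because
    sin(theta) is nonzero. Their m + n + n independent rows exhaust the dimension m + 2n. *)
Let full : row_full (col_mx C (col_mx A F)).
Proof.
set B := col_mx _ _.
have BB : B *m G *m B^T = block_mx S1 0 0 (block_mx S2 0 0 (s2 *: S2)).
  have CGA : C *m G *m A^T = 0.
    by apply: trmx_inj; rewrite !trmx_mul trmxK Gs mulmxA AGC trmx0.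
  have CGF : C *m G *m F^T = 0.
    by apply: trmx_inj; rewrite !trmx_mul trmxK Gs mulmxA FGC trmx0.
  have AGF : A *m G *m F^T = 0.
    by apply: trmx_inj; rewrite !trmx_mul trmxK Gs mulmxA FGA trmx0.
  rewrite /B mul_col_mx tr_col_mx mul_col_row.
  rewrite tr_col_mx (mul_col_mx A F G) mul_mx_row mul_col_row mul_col_mx.
  rewrite CGC CGA CGF AGC FGC AGA AGF FGA FGF.
  by rewrite row_mx0 col_mx0.
have Bu : B *m G *m B^T \in unitmx.
  rewrite BB unitmxE det_ublock det_ublock detZ !unitrM -!unitmxE S1u S2u /=.
  by rewrite andbT unitrX// unitfE gt_eqF.
have Bf : row_free B.
  apply/row_freeP; exists (G *m B^T *m invmx (B *m G *m B^T)).
  by rewrite !mulmxA mulmxV.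
by move: Bf; rewrite /row_full /row_free => /eqP ->; rewrite addnn mul2n.
Qed.

(** Testing against JZ is as good as testing against the normal part of JZ, since they differ by a
    tangent vector, to which u is already orthogonal. *)
Lemma normal_eq0 (u : 'rV[R]_N) : (forall a, ip G u (a *m C) = 0) ->
  (forall b, ip G u (b *m A) = 0) -> (forall b, ip G u (b *m A *m J) = 0) ->
  u = 0.
Proof.
have E l (B : 'M[R]_(l, N)) : (forall a, ip G u (a *m B) = 0) -> u *m G *m B^T = 0.
  move=> H; apply/rowP => i; have := H (delta_mx 0 i).
  by rewrite /ip trmx_mul mulmxA trmx_delta -colE !mxE.
move=> /E uC /E uA H; apply: row_full_orthogonal Gu full _.
have /E uJ : forall a, ip G u (a *m (A *m J)) = 0 by move=> a; rewrite mulmxA.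
rewrite !tr_col_mx !mul_mx_row uC uA /F linearB /= mulmxBr uJ.
have -> : u *m G *m (Th *m A)^T = (u *m G *m A^T) *m Th^T.
  by move: Th => X; rewrite trmx_mul mulmxA.
by rewrite uA mul0mx subrr !row_mx0.
Qed.

(* A normal vector is determined by its products with [J A]: it is [W F] where
   [sin^2 W = al b + be b Th]. *)
Lemma normal_sqnorm (u : 'rV[R]_N) (b : 'rV[R]_n) (al be : R) :
  (forall a, ip G u (a *m C) = 0) -> (forall a, ip G u (a *m A) = 0) ->
  (forall a, ip G u (a *m A *m J) = al * ip S2 b a + be * ip G (b *m A *m J) (a *m A)) ->
  ip G u u = s2^-1 * (al ^+ 2 + c2 * be ^+ 2) * ip S2 b b.
Proof.
move=> uC uA uJ.
pose w := al *: b + be *: (b *m Th).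
have FE a : a *m F = a *m A *m J - (a *m Th) *m A.
  by rewrite /F; move: Th => X; rewrite mulmxBr !mulmxA.
have bT a : ip G (b *m A *m J) (a *m A) = ip S2 (b *m Th) a.
  by rewrite /ip -[b *m Th *m S2]mulmxA ThS /K trmx_mul !mulmxA.
have Fn a : ip G (w *m F) (a *m A) = 0.
  by rewrite /ip trmx_mul -!mulmxA (mulmxA F) (mulmxA (F *m G)) FGA mul0mx mulmx0 mxE.
have FnC a : ip G (w *m F) (a *m C) = 0.
  by rewrite /ip trmx_mul -!mulmxA (mulmxA F) (mulmxA (F *m G)) FGC mul0mx mulmx0 mxE.
have FF a : ip G (w *m F) (a *m F) = s2 * ip S2 w a.
  by rewrite ip_mulmx FGF /ip -scalemxAr -scalemxAl [LHS]mxE.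
have uE : u = s2^-1 *: (w *m F).
  apply/eqP; rewrite -subr_eq0; apply/eqP; apply: normal_eq0 => a.
  - by rewrite ipBl uC ipZl FnC mulr0 subrr.
  - by rewrite ipBl uA ipZl Fn mulr0 subrr.
  rewrite ipBl uJ bT ipZl.
  have -> : a *m A *m J = a *m F + (a *m Th) *m A by rewrite FE subrK.
  rewrite ipDr Fn FF addr0 mulrA mulVf ?gt_eqF// mul1r.
  by rewrite /w ipDl !ipZl subrr.
(* g(JZ, Z) = 0 removes the cross term in [al * be] from the squared norm. *)
have skew : ip S2 b (b *m Th) = 0.
  have E : ip K b b = - ip K b b.
    by rewrite -[LHS]ip_trmx KT /ip mulmxN mulNmx [LHS]mxE.
  rewrite -(ip_sym (b *m Th) b S2s) -bT.
  have -> : ip G (b *m A *m J) (b *m A) = ip K b b.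
    by rewrite /ip /K trmx_mul !mulmxA.
  by lra.
have TT : ip S2 (b *m Th) (b *m Th) = c2 * ip S2 b b.
  by rewrite ip_mulmx ThSTh /ip -scalemxAr -scalemxAl [LHS]mxE.
rewrite uE ipZl ipZr FF {1}/w /w !(ipDl, ipDr, ipZl, ipZr) TT skew.
rewrite (ip_sym (b *m Th) b S2s) skew.
by field; rewrite gt_eqF.
Qed.

End Pointwise.

Lemma sandwich_sym (R : comPzRingType) k l (B : 'M[R]_(l, k)) (G : 'M[R]_k) :
  G^T = G -> (B *m G *m B^T)^T = B *m G *m B^T.
Proof. by move=> Gs; rewrite !trmx_mul trmxK Gs mulmxA. Qed.

(** * The squared norm of h at a point, in an adapted frame *)

Section AdaptedFrame.
Context {R : realType} {m n : nat}.
Variables (S1 E1 : 'M[R]_m) (S2 E2 : 'M[R]_n).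

Lemma adapted_frame : orthonormal_basis S1 E1 -> orthonormal_basis S2 E2 ->
  orthonormal_basis (block_mx S1 0 0 S2) (block_mx E1 0 0 E2).
Proof.
rewrite /orthonormal_basis => E1E E2E.
rewrite tr_block_mx !trmx0 !mulmx_block !(mulmx0, mul0mx, addr0, add0r).
by rewrite E1E E2E -scalar_mx_block.
Qed.

Lemma frame_row_up i : row (lshift n i) (block_mx E1 0 0 E2) = row_mx (row i E1) 0.
Proof. by rewrite /block_mx rowKu row_row_mx row0. Qed.

Lemma frame_row_down i : row (rshift m i) (block_mx E1 0 0 E2) = row_mx 0 (row i E2).
Proof. by rewrite /block_mx rowKd row_row_mx row0. Qed.

End AdaptedFrame.

Section PointwiseSff.
Context {R : realType} {m n : nat}.
Local Notation N := (m + 2 * n)%N.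
Variables (G J : 'M[R]_N) (T : 'M[R]_(m + n, N)) (S1 : 'M[R]_m) (S2 : 'M[R]_n).
Hypotheses (Gs : G^T = G) (Gp : forall v, v != 0 -> 0 < ip G v v).
Hypotheses (JJ : J *m J = - 1%:M)
  (JG : forall u v, ip G (u *m J) (v *m J) = ip G u v).
Hypothesis TGT : T *m G *m T^T = block_mx S1 0 0 S2.
Let C : 'M[R]_(m, N) := row_mx 1%:M 0 *m T.
Let A : 'M[R]_(n, N) := row_mx 0 1%:M *m T.
Hypothesis CJ : (C *m J <= C)%MS.
Variable th : R.
Hypothesis slant : forall X : 'rV[R]_n, X != 0 ->
  subspace_angle G (X *m A *m J) A th.
Hypothesis sth : sin th != 0.
Hypotheses (S1p : forall v, v != 0 -> 0 < ip S1 v v)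
  (S2p : forall v, v != 0 -> 0 < ip S2 v v).
Variables (h : 'rV[R]_(m + n) -> 'rV[R]_(m + n) -> 'rV[R]_N) (d : 'rV[R]_m).
Hypotheses (hsym : forall u v, h u v = h v u) (hlin : forall v, linear (h^~ v)).
Hypothesis hn : forall u v w, ip G (h u v) (w *m T) = 0.
Hypothesis hTT : forall (a c : 'rV[R]_m) (b : 'rV[R]_n),
  ip G (h (row_mx a 0) (row_mx c 0)) (row_mx 0 b *m T *m J) = 0.
Hypothesis hFT : forall (b : 'rV[R]_n) (c c' : 'rV[R]_m) (b' : 'rV[R]_n),
  row_mx c 0 *m T *m J = row_mx c' 0 *m T ->
  ip G (h (row_mx 0 b) (row_mx c 0)) (row_mx 0 b' *m T *m J) =
  - (c' *m d^T) 0 0 * ip S2 b b'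
  - (c *m d^T) 0 0 * ip G (row_mx 0 b *m T) (row_mx 0 b' *m T *m J).

Let TT k l (a : 'M_(k, m)) b (c : 'M_(l, m)) e :
  row_mx a b *m T *m G *m (row_mx c e *m T)^T = a *m S1 *m c^T + b *m S2 *m e^T.
Proof.
have -> : row_mx a b *m T *m G *m (row_mx c e *m T)^T =
    row_mx a b *m (T *m G *m T^T) *m (row_mx c e)^T by rewrite trmx_mul !mulmxA.
rewrite TGT mul_row_block tr_row_mx mul_row_col.
by rewrite !mulmx0 addr0 add0r.
Qed.

Let AGA : A *m G *m A^T = S2.
Proof. by rewrite TT trmx1 trmx0 !(mul1mx, mul0mx, mulmx1, mulmx0, add0r). Qed.

Let CGC : C *m G *m C^T = S1.
Proof. by rewrite TT trmx1 trmx0 !(mul1mx, mul0mx, mulmx1, mulmx0, addr0). Qed.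

Let AGC : A *m G *m C^T = 0.
Proof. by rewrite TT trmx1 trmx0 !(mul1mx, mul0mx, mulmx1, mulmx0, addr0). Qed.

Let S1u : S1 \in unitmx. Proof. exact: posdef_unit. Qed.
Let S2u : S2 \in unitmx. Proof. exact: posdef_unit. Qed.
Let S1s : S1^T = S1. Proof. by rewrite -CGC sandwich_sym. Qed.
Let S2s : S2^T = S2. Proof. by rewrite -AGA sandwich_sym. Qed.

Let rowC (a : 'rV[R]_m) : row_mx a 0 *m T = a *m C.
Proof. by rewrite /C mulmxA mul_mx_row mulmx1 mulmx0. Qed.
Let rowA (b : 'rV[R]_n) : row_mx 0 b *m T = b *m A.
Proof. by rewrite /A mulmxA mul_mx_row mulmx1 mulmx0. Qed.

Let hnC u v a : ip G (h u v) (a *m C) = 0. Proof. by rewrite -rowC. Qed.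
Let hnA u v b : ip G (h u v) (b *m A) = 0. Proof. by rewrite -rowA. Qed.

Lemma sff_base_eq0 (a c : 'rV[R]_m) : h (row_mx a 0) (row_mx c 0) = 0.
Proof.
apply: (normal_eq0 Gs Gp JJ JG AGA CGC AGC CJ slant sth S1p S2p) => // b.
by rewrite -rowA.
Qed.

Let P := C *m J *m pinvmx C.
Let CJE : C *m J = P *m C. Proof. by rewrite mulmxKpV. Qed.

Let PC (a : 'rV[R]_m) : a *m P *m C = a *m C *m J.
Proof. by rewrite -(mulmxA a P C) -CJE mulmxA. Qed.

(** J preserves D^T and the metric, so it takes orthonormal frames of D^T to orthonormal frames. *)
Let PSP : P *m S1 *m P^T = S1.
Proof.
apply/matrixP => i j; rewrite -!ip_delta -ip_mulmx.
have E a b : ip S1 a b = ip G (a *m C) (b *m C) by rewrite ip_mulmx CGC.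
by rewrite !E !PC JG.
Qed.

(** csc^2 + cot^2, which equals (1 + cos^2) / sin^2: the coefficient obtained from
    [sff_mixed_sqnorm] when both sums of squares over a frame equal the same norm. *)
Let k := (sin th)^-1 ^+ 2 + (cos th / sin th) ^+ 2.

Lemma sff_mixed_sqnorm (b : 'rV[R]_n) (c : 'rV[R]_m) :
  ip G (h (row_mx 0 b) (row_mx c 0)) (h (row_mx 0 b) (row_mx c 0)) =
  (sin th ^+ 2)^-1 * ((c *m P *m d^T) 0 0 ^+ 2 + cos th ^+ 2 * (c *m d^T) 0 0 ^+ 2)
  * ip S2 b b.
Proof.
(* [normal_sqnorm] applies with [al] = - JX(ln f) and [be] = X(ln f); the sign is put under the
   square so that [al] is recognized. *)
rewrite -[(c *m P *m d^T) 0 0 ^+ 2]sqrrN.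
apply: (normal_sqnorm Gs Gp JJ JG AGA CGC AGC CJ slant sth S1p S2p) => // a.
rewrite -rowA (hFT _ (c' := c *m P)); last first.
  by rewrite !rowC PC.
rewrite !rowA.
have -> : ip G (b *m A) (a *m A *m J) = - ip G (b *m A *m J) (a *m A).
  by rewrite -JG -[a *m A *m J *m J]mulmxA JJ mulmxN mulmx1 ipNr.
by rewrite mulrN opprK.
Qed.

(** In an adapted frame the sum falls into four blocks: the one on D^T vanishes, the two mixed ones
    agree by symmetry and give the factor 2, and the one on D^theta is kept as it is. *)
Lemma sff_sqnorm_split (E : 'M[R]_(m + n)) (E2 : 'M[R]_n) :
  orthonormal_basis (block_mx S1 0 0 S2) E -> orthonormal_basis S2 E2 ->
  \sum_i \sum_j ip G (h (row i E) (row j E)) (h (row i E) (row j E)) =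
  2 * n%:R * k * ip (invmx S1) d d +
  \sum_i \sum_j ip G (h (row_mx 0 (row i E2)) (row_mx 0 (row j E2)))
                     (h (row_mx 0 (row i E2)) (row_mx 0 (row j E2))).
Proof.
move=> SE SE2.
have [E1 SE1] := orthonormal_basis_exists S1s S1p.
have SE0 := adapted_frame SE1 SE2.
have Su : block_mx S1 0 0 S2 \in unitmx.
  by rewrite unitmxE det_ublock unitrM -!unitmxE S1u S2u.
have hlin' u : linear (h u) by move=> a v w; rewrite !(hsym u) hlin.
pose q u v := ip G (h u v) (h u v).
set E0 := block_mx E1 0 0 E2 in SE0.
(* The frame is replaced in one argument of [h] at a time, because [frame_change] concerns a single
   linear map. *)
have -> : \sum_i \sum_j q (row i E) (row j E) = \sum_i \sum_j q (row i E0) (row j E0).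
  transitivity (\sum_i \sum_j q (row i E) (row j E0)).
    apply: eq_bigr => i _.
    exact: (frame_change G Su SE SE0 (hlin' (row i E))).
  rewrite exchange_big [RHS]exchange_big; apply: eq_bigr => j _.
  exact: (frame_change G Su SE SE0 (hlin (row j E0))).
have mixed : \sum_i \sum_j q (row_mx 0 (row j E2)) (row_mx (row i E1) 0) =
    n%:R * k * ip (invmx S1) d d.
  have E2n j : ip S2 (row j E2) (row j E2) = 1.
    have -> : ip S2 (row j E2) (row j E2) = (E2 *m S2 *m E2^T) j j.
      by rewrite -[RHS]ip_delta -ip_mulmx !rowE.
    by move: SE2; rewrite /orthonormal_basis => ->; rewrite mxE eqxx.
  transitivity (\sum_i n%:R * ((sin th ^+ 2)^-1 *
    ((row i (E1 *m P) *m d^T) 0 0 ^+ 2 + cos th ^+ 2 * (row i E1 *m d^T) 0 0 ^+ 2))).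
    apply: eq_bigr => i _.
    under eq_bigr do rewrite /q sff_mixed_sqnorm E2n mulr1 -row_mul.
    by rewrite sumr_const card_ord mulr_natl.
  rewrite -!mulr_sumr big_split -mulr_sumr /= (sum_sqr_frame d S1u SE1).
  (* Derivatives along JX are derivatives along the rotated frame [E1 *m P], so this sum has the
     same value as the one over [E1]. *)
  rewrite (sum_sqr_frame d S1u (E := E1 *m P)); last first.
    move: PSP; move: P => Q QSQ; rewrite /orthonormal_basis trmx_mul.
    have -> : E1 *m Q *m S1 *m (Q^T *m E1^T) = E1 *m (Q *m S1 *m Q^T) *m E1^T.
      by rewrite !mulmxA.
    by rewrite QSQ.
  by rewrite /k; field.
rewrite big_split_ord /=.
under eq_bigr do rewrite frame_row_up big_split_ord /=.
rewrite big_split /=.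
have -> : \sum_(i < m) \sum_(j < m) q (row_mx (row i E1) 0) (row (lshift n j) E0) = 0.
  apply: big1 => i _; apply: big1 => j _.
  by rewrite /q frame_row_up sff_base_eq0 ip0l.
rewrite add0r.
have -> : \sum_(i < m) \sum_(j < n) q (row_mx (row i E1) 0) (row (rshift m j) E0) =
    n%:R * k * ip (invmx S1) d d.
  rewrite -mixed; apply: eq_bigr => i _; apply: eq_bigr => j _.
  by rewrite frame_row_down /q hsym.
under eq_bigr do rewrite frame_row_down big_split_ord /=.
rewrite big_split /= addrA; congr (_ + _).
  have -> : \sum_(j < n) \sum_(i < m) q (row_mx 0 (row j E2)) (row (lshift n i) E0) =
      n%:R * k * ip (invmx S1) d d.
    rewrite -mixed [RHS]exchange_big; apply: eq_bigr => i _; apply: eq_bigr => j _.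
    by rewrite frame_row_up.
  by ring.
by apply: eq_bigr => i _; apply: eq_bigr => j _; rewrite frame_row_down.
Qed.

Let G0 v : 0 <= ip G v v.
Proof. by have [->|/Gp/ltW//] := eqVneq v 0; rewrite ip0l. Qed.

Lemma sff_sqnorm_ge (E : 'M[R]_(m + n)) :
  orthonormal_basis (block_mx S1 0 0 S2) E ->
  2 * n%:R * k * ip (invmx S1) d d <=
  \sum_i \sum_j ip G (h (row i E) (row j E)) (h (row i E) (row j E)).
Proof.
move=> SE; have [E2 SE2] := orthonormal_basis_exists S2s S2p.
rewrite (sff_sqnorm_split SE SE2) lerDl.
by apply: sumr_ge0 => i _; apply: sumr_ge0.
Qed.

(** For an adapted frame the two sides differ by the D^theta block. A vanishing sum of squares makes
    h zero on pairs of frame vectors, and linearity in each argument extends this. *)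
Lemma sff_fiber_eq0 :
  (forall E : 'M[R]_(m + n), orthonormal_basis (block_mx S1 0 0 S2) E ->
    \sum_i \sum_j ip G (h (row i E) (row j E)) (h (row i E) (row j E)) =
    2 * n%:R * k * ip (invmx S1) d d) ->
  forall b b' : 'rV[R]_n, h (row_mx 0 b) (row_mx 0 b') = 0.
Proof.
move=> heq; have [E2 SE2] := orthonormal_basis_exists S2s S2p.
have [E1 SE1] := orthonormal_basis_exists S1s S1p.
have SE := adapted_frame SE1 SE2.
have := heq _ SE; rewrite (sff_sqnorm_split SE SE2) => /eqP.
rewrite -subr_eq0 addrAC subrr add0r => /eqP s0.
have z i j : h (row_mx 0 (row i E2)) (row_mx 0 (row j E2)) = 0.
  have := psumr_eq0P _ s0 => /(_ (fun i _ => sumr_ge0 _ (fun j _ => G0 _))) /(_ i isT).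
  move=> /psumr_eq0P - /(_ (fun j _ => G0 _)) /(_ j isT) /eqP.
  by apply: contraTeq => /Gp; rewrite lt0r => /andP[].
have lin0 (L : 'rV[R]_(m + n) -> 'rV[R]_N) : linear L ->
    linear (fun b : 'rV[R]_n => L (row_mx 0 b)).
  move=> lL a b b'; rewrite -lL scale_row_mx add_row_mx scaler0 addr0.
  by [].
have hlin' u : linear (h u) by move=> a v w; rewrite !(hsym u) hlin.
move=> b b'.
apply: (linear_frame0 SE2 (L := fun b => h (row_mx 0 b) (row_mx 0 b'))).
  exact: (lin0 (h^~ _)).
move=> i.
by apply: (linear_frame0 SE2 (lin0 _ (hlin' _))).
Qed.

End PointwiseSff.

(** * Calculus in product coordinates *)

Section RowMx.
Context {R : realType}.

Lemma cvg_row (T : topologicalType) n (f : T -> 'rV[R]_n) x :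
  (forall j, {for x, continuous (fun y => f y 0 j)}) -> {for x, continuous f}.
Proof.
move=> fj; apply/cvg_ballP => e e0.
have H : \forall y \near x, forall j, ball (f x 0 j) e (f y 0 j).
  by apply: filter_forall => j; have /cvg_ballP := fj j; apply.
by apply: filterS H => y H; split => // i j; rewrite ord1; exact: H.
Qed.

Lemma differentiable_row_mx (V : normedModType R) k l (a : V -> 'rV[R]_k)
    (b : V -> 'rV[R]_l) x :
  differentiable a x -> differentiable b x ->
  differentiable (fun y => row_mx (a y) (b y)) x.
Proof.
move=> /differentiable_mxP da /differentiable_mxP db.
apply/differentiable_mxP => i j; case: (split_ordP j) => j' ->.
  have -> : (fun y => row_mx (a y) (b y) i (lshift l j') : R^o) = (fun y => a y i j').
    by apply/funext => y; rewrite row_mxEl.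
  exact: da.
have -> : (fun y => row_mx (a y) (b y) i (rshift k j') : R^o) = (fun y => b y i j').
  by apply/funext => y; rewrite row_mxEr.
exact: db.
Qed.

Lemma derive_row_mx (V : normedModType R) k l (a : V -> 'rV[R]_k)
    (b : V -> 'rV[R]_l) x v :
  differentiable a x -> differentiable b x ->
  'D_v (fun y => row_mx (a y) (b y)) x = row_mx ('D_v a x) ('D_v b x).
Proof.
move=> da db; apply/rowP => j.
apply: etrans (esym (derive_coord v 0 j (differentiable_row_mx da db))) _.
case: (split_ordP j) => j' ->.
  rewrite row_mxEl -derive_coord//; congr ('D_v _ x).
  by apply/funext => y; rewrite row_mxEl.
rewrite row_mxEr -derive_coord//; congr ('D_v _ x).
by apply/funext => y; rewrite row_mxEr.
Qed.

Lemma derive_lsubmx k l (y v : 'rV[R]_(k + l)) : 'D_v lsubmx y = lsubmx v :> 'rV[R]_k.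
Proof.
rewrite deriveE; last exact: differentiable_lsubmx.
by rewrite diff_lin //; exact: continuous_lsubmx.
Qed.

Lemma derive_rsubmx k l (y v : 'rV[R]_(k + l)) : 'D_v rsubmx y = rsubmx v :> 'rV[R]_l.
Proof.
rewrite deriveE; last exact: differentiable_rsubmx.
by rewrite diff_lin //; exact: continuous_rsubmx.
Qed.

Lemma derive_comp_lsubmx (W : normedModType R) k l (h : 'rV[R]_k -> W)
    (y v : 'rV[R]_(k + l)) : differentiable h (lsubmx y) ->
  'D_v (h \o lsubmx) y = 'D_(lsubmx v) h (lsubmx y).
Proof.
move=> dh; rewrite derive_comp ?derive_lsubmx//; exact: differentiable_lsubmx.
Qed.

Lemma derive_comp_rsubmx (W : normedModType R) k l (h : 'rV[R]_l -> W)
    (y v : 'rV[R]_(k + l)) : differentiable h (rsubmx y) ->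
  'D_v (h \o rsubmx) y = 'D_(rsubmx v) h (rsubmx y).
Proof.
move=> dh; rewrite derive_comp ?derive_rsubmx//; exact: differentiable_rsubmx.
Qed.

End RowMx.

(** * The product manifold and the warped metric in product charts *)

Section Product.
Context {R : realType} {m n : nat}.
Context {B : charted_space R m} {F : charted_space R n}.
Hypotheses (aB : atlas B) (aF : atlas F).
Let M := prod_space B F.

Lemma prod_chart_img (p : M) y :
  chart_img p y <-> chart_img p.1 (lsubmx y) /\ chart_img p.2 (rsubmx y).
Proof.
split=> [[z [z1 z2] <-]|[[a pa aE] [b pb bE]]].
  by rewrite row_mxKl row_mxKr; split; [exists z.1|exists z.2].
by exists (a, b) => //=; rewrite aE bE hsubmxK.
Qed.

Let prod_transition (p q : M) y : chart_img p y -> chart_dom q (param p y) ->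
  differentiable (fun y => row_mx ((chart q.1 \o param p.1) (lsubmx y))
                                  ((chart q.2 \o param p.2) (rsubmx y))) y.
Proof.
move=> /prod_chart_img[p1 p2] [q1 q2]; apply: differentiable_row_mx.
  apply: (@differentiable_comp _ _ _ _ lsubmx); first exact: differentiable_lsubmx.
  exact: aB.2.
apply: (@differentiable_comp _ _ _ _ rsubmx); first exact: differentiable_rsubmx.
exact: aF.2.
Qed.

Lemma prod_atlas : atlas M.
Proof.
split=> [p|p q y]; last exact: prod_transition.
have [[p1 o1 i1] [K1 c1 d1]] := aB.1 p.1.
have [[p2 o2 i2] [K2 c2 d2]] := aF.1 p.2.
split; split.
- by split.
- have -> : chart_dom p = (fst @^-1` chart_dom p.1) `&` (snd @^-1` chart_dom p.2) by [].
  by apply: openI; apply: open_comp => // y _; [exact: cvg_fst|exact: cvg_snd].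
- have -> : chart_img p = (lsubmx @^-1` chart_img p.1) `&` (rsubmx @^-1` chart_img p.2).
    by apply/seteqP; split=> y /prod_chart_img.
  by apply: openI; apply: open_comp => // y _;
    [exact: continuous_lsubmx|exact: continuous_rsubmx].
- by move=> [x1 x2] [/= /K1 E1 /K2 E2]; rewrite row_mxKl row_mxKr E1 E2.
- move=> x [px1 px2]; apply: cvg_row => j; case: (split_ordP j) => j' ->.
    have -> : (fun y : M => chart p y 0 (lshift n j')) =
        (fun N : 'rV[R]_m => N 0 j') \o (chart p.1 \o fst).
      by apply/funext => y /=; rewrite row_mxEl.
    apply: continuous_comp; last exact: coord_continuous.
    by apply: continuous_comp; [exact: cvg_fst|exact: c1].
  have -> : (fun y : M => chart p y 0 (rshift m j')) =
      (fun N : 'rV[R]_n => N 0 j') \o (chart p.2 \o snd).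
    by apply/funext => y /=; rewrite row_mxEr.
  apply: continuous_comp; last exact: coord_continuous.
  by apply: continuous_comp; [exact: cvg_snd|exact: c2].
- move=> y /prod_chart_img[y1 y2].
  have c1' : {for y, continuous (param p.1 \o lsubmx)}.
    by apply: continuous_comp; [exact: continuous_lsubmx|exact: d1].
  have c2' : {for y, continuous (param p.2 \o rsubmx)}.
    by apply: continuous_comp; [exact: continuous_rsubmx|exact: d2].
  exact: (cvg_pair c1' c2').
Qed.

(** Product transitions act on the two halves of the coordinates separately; hence vectors tangent
    to a slice have the same zero block in every product chart. *)
Lemma prod_trans (p q x : M) : chart_dom p x -> chart_dom q x ->
  trans p q x = block_mx (trans p.1 q.1 x.1) 0 0 (trans p.2 q.2 x.2).
Proof.
move=> px qx; apply: mulmx_row_inj => u.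
have py : chart_img p (chart p x) by exact: chart_img_chart.
have qy : chart_dom q (param p (chart p x)) by rewrite (chartK prod_atlas).
rewrite /trans -deriveEjacobian; last exact: prod_transition.
have [p1 p2] := (prod_chart_img p _).1 py.
have [q1 q2] := qy.
have d1 : differentiable (chart q.1 \o param p.1) (lsubmx (chart p x)) by exact: aB.2.
have d2 : differentiable (chart q.2 \o param p.2) (rsubmx (chart p x)) by exact: aF.2.
rewrite -[u in RHS]hsubmxK mul_row_block !mulmx0 addr0 add0r.
apply: etrans (derive_row_mx u (differentiable_comp (differentiable_lsubmx _) d1)
  (differentiable_comp (differentiable_rsubmx _) d2)) _.
have E1 := derive_comp_lsubmx u d1; have E2 := derive_comp_rsubmx u d2.
rewrite row_mxKl in d1 E1; rewrite row_mxKr in d2 E2.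
by rewrite E1 E2 !deriveEjacobian.
Qed.

Lemma warped_metric_in (g1 : B -> 'M[R]_m) (g2 : F -> 'M[R]_n) (f : B -> R)
    (p : M) y : chart_img p y ->
  metric_in (warped_metric g1 g2 f) p y =
  block_mx (metric_in g1 p.1 (lsubmx y)) 0 0
    (f (param p.1 (lsubmx y)) ^+ 2 *: metric_in g2 p.2 (rsubmx y)).
Proof.
move=> py; have := (prod_chart_img p y).1 py => -[py1 py2].
rewrite /metric_in prod_trans; last 2 first.
- exact: (chart_dom_param prod_atlas).
- exact: (chart_dom_refl prod_atlas).
rewrite /warped_metric tr_block_mx !trmx0 !mulmx_block.
rewrite !(mulmx0, mul0mx, addr0, add0r) /=.
by rewrite -scalemxAr -scalemxAl.
Qed.

End Product.

(** * Submanifolds whose inclusion is affine in charts *)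

Section AffineSlice.
Context {R : realType} {k l n : nat}.
Context {M' : charted_space R k} {M : charted_space R l} {N : charted_space R n}.
Hypotheses (aM' : atlas M') (aM : atlas M) (aN : atlas N).
Variables (s : M' -> M) (L : 'M[R]_(k, l)) (c : M' -> 'rV[R]_l).
Hypothesis cs : continuous s.
(** In product charts the inclusion of a slice inserts the varying coordinates by [L] and the fixed
    ones by [c]; this formulation covers both families of slices. *)
Hypothesis sE : forall p y, chart_img p y ->
  chart_img (s p) (y *m L + c p) /\ param (s p) (y *m L + c p) = s (param p y).
Variables (g : N -> 'M[R]_n) (Phi : M -> N).
Hypothesis cPhi : C2_map Phi.
Let Psi : M' -> N := Phi \o s.
Implicit Types (p : M') (r : N) (y : 'rV[R]_k).

Let aff p (y : 'rV[R]_k) : 'rV[R]_l := y *m L + c p.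

Let aff_differentiable p y : differentiable (aff p) y.
Proof.
apply: differentiableD; last exact: differentiable_cst.
by apply: differentiable_mulmx; last exact: differentiable_cst.
Qed.

Let derive_aff p y v : 'D_v (aff p) y = v *m L.
Proof.
have dL : differentiable (fun y : 'rV[R]_k => y *m L) y.
  by apply: differentiable_mulmx; last exact: differentiable_cst.
have E : 'D_v (fun y : 'rV[R]_k => y *m L) y = v *m L.
  have did : differentiable (id : 'rV[R]_k -> 'rV[R]_k) y by [].
  have := derive_mulmx v did (differentiable_cst L y).
  by rewrite derive_cst mulmx0 addr0 derive_id.
rewrite -[RHS]addr0 -{1}E -(derive_cst (c p) y v).
exact: (deriveD (diff_derivable dL) (derivable_cst _ _ _)).
Qed.

Let near_img p y : chart_img p y -> \forall y' \near y, chart_img p y'.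
Proof. by move=> py; have [[_ _ oI] _] := aM'.1 p; exact: open_nbhs_nbhs. Qed.

Let map_in_slice p r y : chart_img p y ->
  map_in Psi p r y = (map_in Phi (s p) r \o aff p) y.
Proof. by move=> /sE[_ /= E]; rewrite /map_in /= E. Qed.

Let inner_dom p r y : chart_img p y -> chart_dom r (Psi (param p y)) ->
  chart_img (s p) (aff p y) /\ chart_dom r (Phi (param (s p) (aff p y))).
Proof. by move=> /sE[sy E] ry; rewrite /aff E. Qed.

Lemma slice_C1 : C1_map Psi.
Proof.
split.
  by move=> z; apply: continuous_comp; [exact: cs|exact: cPhi.1.1].
move=> p r y py ry; have [sy Ry] := inner_dom py ry.
apply: (@near_eq_differentiable _ _ _ (map_in Phi (s p) r \o aff p)).
  by apply: filterS (near_img py) => y' py'; rewrite -map_in_slice.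
apply: differentiable_comp; first exact: aff_differentiable.
exact: (map_in_differentiable cPhi.1 sy Ry).
Qed.

Lemma derive_slice p r y v : chart_img p y -> chart_dom r (Psi (param p y)) ->
  'D_v (map_in Psi p r) y = 'D_(v *m L) (map_in Phi (s p) r) (aff p y).
Proof.
move=> py ry; have [sy Ry] := inner_dom py ry.
have E : \forall y' \near y, map_in Psi p r y' = (map_in Phi (s p) r \o aff p) y'.
  by apply: filterS (near_img py) => y' py'; exact: map_in_slice.
apply: etrans (near_eq_derive v E) _.
rewrite -(derive_aff p y); apply: derive_comp; first exact: aff_differentiable.
exact: (map_in_differentiable cPhi.1 sy Ry).
Qed.

Let near_derive_slice p r y v : chart_img p y -> chart_dom r (Psi (param p y)) ->
  \forall y' \near y,
    'D_v (map_in Psi p r) y' = ('D_(v *m L) (map_in Phi (s p) r) \o aff p) y'.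
Proof.
move=> py ry; apply: filterS (near_map_in aM' aN slice_C1 py ry) => y' [py' ry'].
exact: derive_slice.
Qed.

Lemma slice_C2 : C2_map Psi.
Proof.
split; first exact: slice_C1.
move=> p r y v py ry; have [sy Ry] := inner_dom py ry.
apply: (@near_eq_differentiable _ _ _ ('D_(v *m L) (map_in Phi (s p) r) \o aff p)).
  by apply: filterS (near_derive_slice v py ry) => y' ->.
apply: differentiable_comp; first exact: aff_differentiable.
exact: (cPhi.2 _ _ _ _ sy Ry).
Qed.

Let slice_center p : aff p (chart p p) = chart (s p) (s p).
Proof.
have pp := chart_dom_refl aM' p.
have [sy sK] := sE (chart_img_chart pp).
rewrite (chartK aM' pp) in sK.
by have := paramK aM sy; rewrite sK.
Qed.

Lemma slice_tangent_map p : tangent_map Psi p = L *m tangent_map Phi (s p).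
Proof.
apply: mulmx_row_inj => u.
have pp := chart_dom_refl aM' p; have py := chart_img_chart pp.
have ry : chart_dom (Psi p) (Psi (param p (chart p p))).
  by rewrite chartK//; exact: chart_dom_refl.
apply: etrans (esym (derive_map_in slice_C1 u py ry)) _.
apply: etrans (derive_slice u py ry) _.
rewrite slice_center mulmxA; apply: (derive_map_in cPhi.1).
  by apply: chart_img_chart; exact: chart_dom_refl.
by rewrite chartK//; exact: chart_dom_refl.
Qed.

(** An affine inclusion has no second derivative, so the chain rule adds no term. *)
Lemma slice_ambient_sff p u v :
  ambient_sff g Psi p u v = ambient_sff g Phi (s p) (u *m L) (v *m L).
Proof.
have pp := chart_dom_refl aM' p; have py := chart_img_chart pp.
have ry : chart_dom (Psi p) (Psi (param p (chart p p))).
  by rewrite chartK//; exact: chart_dom_refl.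
have [sy Ry] := inner_dom py ry.
have E : 'D_u ('D_v (map_in Psi p (Psi p))) (chart p p) =
    'D_(u *m L) ('D_(v *m L) (map_in Phi (s p) (Psi p))) (chart (s p) (s p)).
  apply: etrans (near_eq_derive u (near_derive_slice v py ry)) _.
  apply: etrans (@derive_comp _ _ _ _ (aff p) _ _ _ (aff_differentiable _ _) _) _.
    exact: (cPhi.2 _ _ _ _ sy Ry).
  by rewrite derive_aff slice_center.
rewrite /ambient_sff slice_tangent_map !mulmxA; exact: (f_equal (+%R^~ _) E).
Qed.

Lemma slice_pullback p : pullback Psi g p = L *m pullback Phi g (s p) *m L^T.
Proof. by rewrite /pullback slice_tangent_map trmx_mul !mulmxA. Qed.

(* The slice differs from the ambient submanifold by a tangent vector, which is
   normal to the slice. *)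
Lemma slice_sff p u v : riemannian_metric g -> pullback Psi g p \in unitmx ->
  sff g Phi (s p) (u *m L) (v *m L) = 0 ->
  exists2 w, sff g Psi p u v = (christoffel (pullback Phi g) (s p)
      (chart (s p) (s p)) (u *m L) (v *m L) - w *m L) *m tangent_map Phi (s p)
    & forall z, ip (pullback Phi g (s p)) (christoffel (pullback Phi g) (s p)
      (chart (s p) (s p)) (u *m L) (v *m L) - w *m L) (z *m L) = 0.
Proof.
move=> gR pu; rewrite (sffE aM aN g cPhi) => /eqP; rewrite subr_eq0 => /eqP BE.
exists (christoffel (pullback Psi g) p (chart p p) u v).
  rewrite (sffE aM' aN g slice_C2) slice_ambient_sff BE slice_tangent_map.
  by rewrite mulmxA -mulmxBl.
move=> z; have := sff_normal aM' aN slice_C2 gR pu u v z.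
rewrite (sffE aM' aN g slice_C2) slice_ambient_sff BE slice_tangent_map.
by rewrite !mulmxA -mulmxBl ip_mulmx.
Qed.

End AffineSlice.

(** * The condition nabla J = 0 in coordinates *)

Section Kaehler.
Context {R : realType} {n : nat} {M : charted_space R n}.
Variables (g J : M -> 'M[R]_n).
Hypothesis K : kaehler g J.

Let mM : smooth_manifold M. Proof. by have [] := K. Qed.
Let aM : atlas M. Proof. exact: smooth_manifold_atlas. Qed.

Lemma overlap_open (p q : M) : open [set y | chart_img p y /\ chart_dom q (param p y)].
Proof.
rewrite openE => y [py qy]; apply: (near_param aM py).
exact: (near_dom aM qy).
Qed.

(** [kaehler] states nabla J = 0 for smooth local fields, so smoothness is required before it can be
    applied to a coordinate field. In the chart p the components are a derivative of the transition
    from x to p, composed with the transition back. *)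
Lemma coord_field_smooth (x : M) v : smooth_field_on (chart_dom x) (coord_field x v).
Proof.
move=> p.
have [_ _ _ sm] := mM.
have sc := smooth_on_comp (@overlap_open p x) _ (@overlap_open x p) (sm p x)
   (smooth_on_derive v (sm x p)).
apply: smooth_on_eq (@overlap_open p x) _ (sc _) => y [py xz] /=; set z := param p y.
  have pz : chart_dom p z by exact: chart_dom_param.
  rewrite /field_in /coord_field -/z -mulmxA (trans_mul aM xz (chart_dom_refl aM z) pz).
  rewrite deriveEjacobian//; apply: aM.2; first exact: chart_img_chart.
  by rewrite chartK.
split; first exact: chart_img_chart.
by rewrite chartK//; exact: chart_dom_param.
Qed.

Lemma endo_in_center (x : M) : endo_in J x (chart x x) = J x.
Proof.
have xx := chart_dom_refl aM x.
by rewrite /endo_in chartK// trans_refl// mul1mx mulmx1.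
Qed.

Lemma endo_in_differentiable (x : M) : differentiable (endo_in J x) (chart x x).
Proof.
have [_ _ sJ _] := K; apply: smooth_on_differentiable (sJ x) _.
exact: chart_img_chart (chart_dom_refl aM x).
Qed.

(** For the field with constant components v, nabla J = 0 at the centre of the chart becomes an
    algebraic relation between the derivative of J and the Christoffel terms. *)
Lemma kaehler_parallel (x : M) (u v : 'rV[R]_n) :
  v *m 'D_u (endo_in J x) (chart x x) + christoffel g x (chart x x) u (v *m J x) =
  christoffel g x (chart x x) u v *m J x.
Proof.
have [_ _ _ [_ _ par]] := K.
have xx := chart_dom_refl aM x.
have [[_ ox _] _] := aM.1 x.
have := par _ _ ox (@coord_field_smooth x v) x xx u.
have cx : coord_field x v x = v by rewrite /coord_field trans_refl// mulmx1.
have tid : tangent_map (idfun : M -> M) x = 1%:M by exact: trans_refl.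
have E1 : 'D_u (field_in idfun (fun z => coord_field x v z *m J z) x x) (chart x x) =
    v *m 'D_u (endo_in J x) (chart x x).
  have -> : field_in idfun (fun z => coord_field x v z *m J z) x x =
      (fun y => cst v y *m endo_in J x y).
    by apply/funext => y; rewrite /field_in /coord_field /endo_in !mulmxA.
  rewrite (derive_mulmx _ (differentiable_cst _ _) (endo_in_differentiable x)).
  by rewrite derive_cst mul0mx add0r.
have E2 : 'D_u (field_in idfun (coord_field x v) x x) (chart x x) = 0.
  have nE : \forall y \near chart x x, field_in idfun (coord_field x v) x x y = cst v y.
    have [[_ _ oI] _] := aM.1 x.
    have : nbhs (chart x x) (chart_img x).
      by apply: open_nbhs_nbhs; split=> //; exact: chart_img_chart.
    by apply: filterS => y; exact: coord_field_in.
  have := @near_eq_derive _ _ _ _ (cst v) (chart x x) u nE.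
  by rewrite derive_cst.
rewrite /cov tid mulmx1 cx => EK.
apply: etrans (f_equal (+%R^~ _) (esym E1)) _.
apply: etrans EK _.
apply: (f_equal (mulmx^~ _)); apply: etrans (f_equal (+%R^~ _) E2) _.
exact: add0r.
Qed.

End Kaehler.

(** * The warped product connection and the normal components of h *)

Lemma derive_sqr_mul (R : realType) (V : normedModType R) (p q : V -> R^o) x v :
  differentiable p x -> differentiable q x -> 'D_v q x = 0 ->
  'D_v (fun y => p y ^+ 2 * q y : R^o) x = 2 * p x * 'D_v p x * q x.
Proof.
move=> /(@diff_derivable _ _ _ _ _ v) dp /(@diff_derivable _ _ _ _ _ v) dq q0.
have -> : (fun y => p y ^+ 2 * q y : R^o) = ((p : V -> R) * (p : V -> R)) * (q : V -> R).
  by apply/funext => y; rewrite expr2.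
apply: etrans (deriveM (derivableM dp dp) dq) _.
rewrite q0 scaler0 add0r; apply: etrans (f_equal (GRing.scale (q x)) (deriveM dp dp)) _.
by rewrite /GRing.scale /=; ring.
Qed.

Definition dlog (R : realType) m (B : charted_space R m) (f : B -> R) (p : B) :
    'rV[R]_m :=
  \row_i 'D_(delta_mx 0 i) (fun y => ln (f (param p y)) : R^o) (chart p p).

Section WarpedSemiSlant.
Context {R : realType} {m n k : nat}.
Variables (N : charted_space R k) (g J : N -> 'M[R]_k).
Variables (B : charted_space R m) (F : charted_space R n).
Variables (g1 : B -> 'M[R]_m) (g2 : F -> 'M[R]_n) (f : B -> R).
Let M := prod_space B F.
Variables (Phi : M -> N) (theta : M -> R).
Hypothesis (kN : kaehler g J) (hM : warped_semi_slant g1 g2 g J f Phi theta).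

Lemma warped_atlasN : atlas N.
Proof. by have [sN _ _ _] := kN; exact: smooth_manifold_atlas. Qed.

Lemma warped_atlasB : atlas B.
Proof. by have [[sB _] _ _ _ _] := hM; exact: smooth_manifold_atlas. Qed.

Lemma warped_atlasF : atlas F.
Proof. by have [_ [sF _] _ _ _] := hM; exact: smooth_manifold_atlas. Qed.

Lemma warped_atlas : atlas M.
Proof. exact: prod_atlas warped_atlasB warped_atlasF. Qed.

Lemma warped_C2 : C2_map Phi.
Proof. by have [_ _ _ [sP _] _] := hM; exact: smooth_map_C2. Qed.

Lemma kaehler_metric : riemannian_metric g. Proof. by have [] := kN. Qed.

Lemma pullback_warped : pullback Phi g = warped_metric g1 g2 f.
Proof. by apply/funext => x; have [_ _ _ [_ +] _] := hM; apply. Qed.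

Lemma kaehler_isometry x u v : ip (g x) (u *m J x) (v *m J x) = ip (g x) u v.
Proof. by have [_ _ _ [_ + _]] := kN; apply. Qed.

Lemma kaehler_skew x u v : ip (g x) (u *m J x) v = - ip (g x) u (v *m J x).
Proof.
have [_ _ _ [/(_ x) JJ _ _]] := kN.
by rewrite -[LHS]kaehler_isometry -mulmxA JJ mulmxN mulmx1 ipNl.
Qed.

Lemma base_invariant x (c : 'rV[R]_m) : exists c' : 'rV[R]_m,
  row_mx c 0 *m tangent_map Phi x *m J (Phi x) = row_mx c' 0 *m tangent_map Phi x.
Proof.
have [_ _ _ _ [_ _ /(_ x)/andP[/submxP[P PE] _] _]] := hM.
exists (c *m P).
have E (a : 'rV[R]_m) : row_mx a 0 = a *m tangent_base x.
  by rewrite /tangent_base mul_mx_row mulmx1 mulmx0.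
rewrite (E c) (E (c *m P)); move: PE; move: (tangent_base x) => t PE.
have -> : c *m t *m tangent_map Phi x *m J (Phi x) =
    c *m (t *m tangent_map Phi x *m J (Phi x)) by rewrite !mulmxA.
by rewrite PE !mulmxA.
Qed.

Variable x : M.
Let y0 := chart x x.
Let phi := map_in Phi x (Phi x).
Let T := tangent_map Phi x.
Let G := metric_in g (Phi x).
Let G0 := g (Phi x).
Let Jx := J (Phi x).
Let Bf := ambient_sff g Phi x.
Let Gh := christoffel (pullback Phi g) x y0.
Let Wh := metric_in (pullback Phi g) x.
Let S1 := g1 x.1.
Let S2 := f x.1 ^+ 2 *: g2 x.2.

Lemma pullback_block z : pullback Phi g z = block_mx (g1 z.1) 0 0 (f z.1 ^+ 2 *: g2 z.2).
Proof. by rewrite pullback_warped. Qed.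

Lemma ip_block (A : 'M[R]_m) (D : 'M[R]_n) a b c d :
  ip (block_mx A 0 0 D) (row_mx a b) (row_mx c d) = ip A a c + ip D b d.
Proof.
by rewrite /ip mul_row_block tr_row_mx mul_row_col !mulmx0 addr0 add0r mxE.
Qed.

Lemma base_metric_posdef v : v != 0 -> 0 < ip S1 v v.
Proof. by have [[_ [_ + _]] _ _ _ _] := hM; apply. Qed.

Lemma fiber_metric_posdef v : v != 0 -> 0 < ip S2 v v.
Proof.
have [_ [_ [_ g2p _]] [_ fp] _ _] := hM => v0.
have -> : ip S2 v v = f x.1 ^+ 2 * ip (g2 x.2) v v.
  by rewrite /ip -scalemxAr -scalemxAl [LHS]mxE.
by rewrite mulr_gt0 ?exprn_gt0 ?g2p.
Qed.

Lemma pullback_unit : pullback Phi g x \in unitmx.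
Proof.
rewrite pullback_block unitmxE det_ublock unitrM -!unitmxE.
by rewrite !posdef_unit//; [exact: fiber_metric_posdef|exact: base_metric_posdef].
Qed.

(** g(JX, Z) for the coordinate fields X = (c, 0) and Z = (0, b), written in the ambient chart at
    [Phi x]. *)
Let s (c : 'rV[R]_m) (b : 'rV[R]_n) (y : 'rV[R]_(m + n)) : R^o :=
  ip ((G \o phi) y) ('D_(row_mx c 0) phi y *m (endo_in J (Phi x) \o phi) y)
    ('D_(row_mx 0 b) phi y).

(** Vanishing on a neighbourhood is what permits differentiation. At nearby z the fields are still
    tangent to the slices, as transitions are block diagonal; then JX stays in D^T, orthogonal to
    Z. *)
Let s_eq0 c b : \forall y \near y0, s c b y = 0.
Proof.
have aM := warped_atlas; have aN := warped_atlasN; have cP := warped_C2.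
apply: filterS (near_center aM aN cP x) => y [xy Fxy].
rewrite /s /= !(derive_map_in cP.1)//; set z := param x y.
have xz : chart_dom x z by exact: chart_dom_param.
have zz := chart_dom_refl aM z.
have Fzz := chart_dom_refl aN (Phi z).
have jE : jacobian (map_in Phi x (Phi x)) y =
    trans x z z *m tangent_map Phi z *m trans (Phi z) (Phi x) (Phi z).
  have yE : y = chart x z by rewrite paramK.
  rewrite [in LHS]yE; exact: (jacobian_change aM aN cP.1 xz zz Fxy Fzz).
have FzE : param (Phi x) (phi y) = Phi z by rewrite /phi /map_in /= chartK.
have tt := trans_inv aN Fzz Fxy.
rewrite jE /G /metric_in /endo_in FzE prod_trans//; [|exact: warped_atlasB|exact: warped_atlasF].
move: tt (trans x.1 z.1 z.1) (trans x.2 z.2 z.2) => tt t1 t2.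
move: (trans (Phi z) (Phi x) (Phi z)) (trans (Phi x) (Phi z) (Phi z)) tt => r' r rr.
rewrite !mulmxA !mul_row_block !mulmx0 !mul0mx !addr0 !add0r.
have [c' cE] := base_invariant z (c *m t1).
rewrite -(mulmxA _ r' r) rr mulmx1 cE.
rewrite /ip !trmx_mul -!mulmxA (mulmxA r' r) rr mul1mx.
rewrite (mulmxA r^T) -[r^T *m _]trmx_mul rr trmx1 mul1mx.
have -> : row_mx c' 0 *m (tangent_map Phi z *m (g (Phi z) *m ((tangent_map Phi z)^T *m (row_mx 0 (b *m t2))^T)))
   = row_mx c' 0 *m pullback Phi g z *m (row_mx 0 (b *m t2))^T.
  by rewrite /pullback !mulmxA.
by rewrite pullback_block -/(ip _ _ _) ip_block ip0r ip0l addr0.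
Qed.

(* Differentiate [g (J V, Z) = 0], using that [g] and [J] are parallel. *)
Lemma ambient_sff_parallel u (V V' Z : 'rV[R]_(m + n)) :
  (\forall y \near y0, ip ((G \o phi) y)
    ('D_V phi y *m (endo_in J (Phi x) \o phi) y) ('D_Z phi y) = 0) ->
  V *m T *m Jx = V' *m T ->
  ip G0 (Bf u V) (Z *m T *m Jx) = ip (pullback Phi g x) (Gh u Z) V'.
Proof.
move=> s0 VJ.
have aM := warped_atlas; have aN := warped_atlasN; have cP := warped_C2.
have gR := kaehler_metric; have [gs gp gS] := gR.
have FF := chart_dom_refl aN (Phi x).
have phi0 : phi y0 = chart (Phi x) (Phi x) by exact: map_center.
have Gd : differentiable G (phi y0).
  by rewrite phi0; apply: smooth_on_differentiable (gS (Phi x)) _; exact: chart_img_chart.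
have Gc : G (phi y0) = G0 by rewrite phi0 /G metric_in_center.
have Gu : G (phi y0) \in unitmx by rewrite Gc; apply: posdef_unit => v; exact: gp.
have dphi : differentiable phi y0 := nbhs_singleton (center_differentiable aM aN cP x).
have dJ : differentiable (endo_in J (Phi x)) (phi y0).
  by rewrite phi0; exact: (endo_in_differentiable kN (Phi x)).
have dV v : differentiable ('D_v phi) y0 by exact: (center_derive_differentiable aM aN cP x v).
have cen v : 'D_v phi y0 = v *m T by exact: (derive_center aM aN cP).
have dJp := differentiable_comp dphi dJ.
have dGp := differentiable_comp dphi Gd.
have dW := differentiable_mulmx (dV V) dJp.
pose W y := 'D_V phi y *m (endo_in J (Phi x) \o phi) y.
pose ipW y : R^o := ip ((G \o phi) y) (W y) ('D_Z phi y).
have D0 : 'D_u ipW y0 = 0.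
  have := @near_eq_derive _ _ _ ipW (cst 0) y0 u s0.
  by rewrite derive_cst.
have DJ : 'D_u (endo_in J (Phi x) \o phi) y0 = 'D_(u *m T) (endo_in J (Phi x)) (phi y0).
  by rewrite -cen; exact: derive_comp.
have DG : 'D_u (G \o phi) y0 = 'D_(u *m T) G (phi y0).
  by rewrite -cen; exact: derive_comp.
have Jc : (endo_in J (Phi x) \o phi) y0 = Jx.
  by have := endo_in_center kN (Phi x); rewrite -phi0.
have E1 := @derive_ip _ _ _ (G \o phi) W ('D_Z phi) y0 u dGp dW (dV Z).
have E0 : 'D_u ipW y0 = _ := E1.
rewrite D0 in E0.
have DW := derive_mulmx u (dV V) dJp.
rewrite DW DJ DG Jc !cen [(G \o phi) y0]Gc in E0.
have MC v w : ip ('D_(u *m T) G (phi y0)) v w =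
    ip G0 (christoffel g (Phi x) (phi y0) (u *m T) v) w +
    ip G0 v (christoffel g (Phi x) (phi y0) (u *m T) w).
  by rewrite -Gc; exact: (metric_compatible Gd Gu gs).
rewrite MC in E0.
have W0 : W y0 = V *m T *m Jx by rewrite /W Jc cen.
rewrite W0 in E0.
(* This trades the derivative of J in [E0] for Christoffel terms. *)
have Kp := kaehler_parallel kN (Phi x) (u *m T) (V *m T).
rewrite -phi0 in Kp.
have EB v : Bf u v = 'D_u ('D_v phi) y0 + christoffel g (Phi x) (phi y0) (u *m T) (v *m T).
  by rewrite phi0.
move: E0 Kp (EB V) (EB Z).
move: ('D_u ('D_V phi) y0) ('D_u ('D_Z phi) y0) => a z.
move: ('D_(u *m T) (endo_in J (Phi x)) (phi y0)) => e.
move: (christoffel g (Phi x) (phi y0)) => Gam E0 Kp EV EZ.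
have skew := kaehler_skew (Phi x) (Bf u V) (Z *m T).
have -> : ip G0 (Bf u V) (Z *m T *m Jx) = - ip G0 (Bf u V *m Jx) (Z *m T).
  by rewrite skew opprK.
rewrite -(ambient_sff_tangent aM aN cP gR pullback_unit) -/(Bf _ _) -VJ.
rewrite (ip_sym _ _ (gs _)) EZ ipDr EV mulmxDl ipDl.
move: E0; rewrite ipDl.
have -> : V *m T *m e = Gam (u *m T) (V *m T) *m Jx - Gam (u *m T) (V *m T *m Jx).
  by rewrite -Kp addrK.
rewrite ipBl /G0.
lra.
Qed.

Lemma ambient_sff_normal u (c c' : 'rV[R]_m) (b : 'rV[R]_n) :
  row_mx c 0 *m T *m Jx = row_mx c' 0 *m T ->
  ip G0 (Bf u (row_mx c 0)) (row_mx 0 b *m T *m Jx) =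
  ip (pullback Phi g x) (Gh u (row_mx 0 b)) (row_mx c' 0).
Proof. by apply: ambient_sff_parallel; exact: s_eq0. Qed.

Let yb := chart x.1 x.1.
Let fh (y : 'rV[R]_m) : R^o := f (param x.1 y).
Let d := dlog f x.1.

Let lsub_y0 : lsubmx y0 = yb. Proof. exact: row_mxKl. Qed.
Let rsub_y0 : rsubmx y0 = chart x.2 x.2. Proof. exact: row_mxKr. Qed.

Let fh_differentiable : differentiable fh yb.
Proof.
have [_ _ [sf _] _ _] := hM; apply: smooth_on_differentiable (sf x.1) _.
exact: chart_img_chart (chart_dom_refl warped_atlasB x.1).
Qed.

Let fh_center : fh yb = f x.1.
Proof.
by rewrite /fh /yb (chartK warped_atlasB)//; exact: chart_dom_refl warped_atlasB _.
Qed.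

Let fh_gt0 : 0 < fh yb.
Proof. by have [_ _ [_ fp] _ _] := hM; exact: fp. Qed.

Let ln_differentiable : differentiable (@ln R : R^o -> R^o) (fh yb).
Proof. by apply/derivable1_diffP; exact: (@ex_derive _ _ _ _ _ _ _ (is_derive1_ln fh_gt0)). Qed.

Let ln_fh_differentiable : differentiable (fun y => ln (fh y) : R^o) yb.
Proof. exact: (@differentiable_comp _ _ _ _ fh (@ln R : R^o -> R^o)). Qed.

Lemma derive_ln_warping e :
  (e *m d^T) 0 0 = (f x.1)^-1 * 'D_e fh yb.
Proof.
have -> : (e *m d^T) 0 0 = 'D_e (fun y => ln (fh y) : R^o) yb.
  rewrite derive_rowE// mxE; apply: eq_bigr => i _; rewrite !mxE //.
apply: etrans (@derive_comp _ _ _ _ fh (@ln R : R^o -> R^o) yb e fh_differentiable ln_differentiable) _.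
have Dln : 'D_1 (@ln R : R^o -> R^o) (fh yb) = (fh yb)^-1.
  exact: (@derive_val _ _ _ _ _ _ _ (is_derive1_ln fh_gt0)).
rewrite -fh_center -Dln; move: ('D_e fh yb) => h.
have := derive_linear ln_differentiable h 1 0.
rewrite derive0 !addr0 => L; rewrite [RHS]mulrC; apply: etrans _ L.
by rewrite [h *: 1]mulr1.
Qed.

Let Wh_differentiable : differentiable Wh y0.
Proof. exact: (pullback_differentiable warped_atlas warped_atlasN warped_C2 kaehler_metric). Qed.

Let Wh_center : Wh y0 = pullback Phi g x.
Proof. exact: metric_in_center warped_atlas _ _. Qed.

Let near_Wh : \forall y \near y0, Wh y = block_mx (metric_in g1 x.1 (lsubmx y)) 0 0
  (fh (lsubmx y) ^+ 2 *: metric_in g2 x.2 (rsubmx y)).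
Proof.
apply: filterS (near_center warped_atlas warped_atlasN warped_C2 x) => y [xy _].
by rewrite /Wh pullback_warped (warped_metric_in warped_atlasB warped_atlasF).
Qed.

Let derive_WhE u v w (h : 'rV[R]_(m + n) -> R^o) :
  (\forall y \near y0, ip (Wh y) v w = h y) ->
  ip ('D_u Wh y0) v w = 'D_u h y0.
Proof.
move=> E; apply: etrans (esym (derive_ip_const u v w Wh_differentiable)) _.
exact: near_eq_derive E.
Qed.

Let Wh_mixed u a b : ip ('D_u Wh y0) (row_mx a 0) (row_mx 0 b) = 0.
Proof.
apply: etrans (@derive_WhE u _ _ (cst 0) _) (derive_cst _ _ _).
by apply: filterS near_Wh => y ->; rewrite ip_block ip0r ip0l addr0.
Qed.

Let Wh_mixed' u a b : ip ('D_u Wh y0) (row_mx 0 b) (row_mx a 0) = 0.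
Proof.
apply: etrans (@derive_WhE u _ _ (cst 0) _) (derive_cst _ _ _).
by apply: filterS near_Wh => y ->; rewrite ip_block ip0r ip0l addr0.
Qed.

Let g1_differentiable : differentiable (metric_in g1 x.1) (lsubmx y0).
Proof.
have [[_ [_ _ sg]] _ _ _ _] := hM; apply: smooth_on_differentiable (sg x.1) _.
by rewrite lsub_y0; exact: chart_img_chart (chart_dom_refl warped_atlasB x.1).
Qed.

Let g2_differentiable : differentiable (metric_in g2 x.2) (rsubmx y0).
Proof.
have [_ [_ [_ _ sg]] _ _ _] := hM; apply: smooth_on_differentiable (sg x.2) _.
by rewrite rsub_y0; exact: chart_img_chart (chart_dom_refl warped_atlasF x.2).
Qed.

Let ip_const_differentiable p (A : 'rV[R]_p -> 'M[R]_p) y a c :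
  differentiable A y -> differentiable (fun z => ip (A z) a c : R^o) y.
Proof. by move=> dA; apply: differentiable_ip => //; exact: differentiable_cst. Qed.

Let Wh_base e a c : ip ('D_(row_mx 0 e) Wh y0) (row_mx a 0) (row_mx c 0) = 0.
Proof.
pose h (z : 'rV[R]_m) : R^o := ip (metric_in g1 x.1 z) a c.
apply: etrans (@derive_WhE _ _ _ (h \o lsubmx) _) _.
  by apply: filterS near_Wh => y ->; rewrite ip_block !ip0r addr0.
apply: etrans (derive_comp_lsubmx _ (ip_const_differentiable _ _ g1_differentiable)) _.
by rewrite (row_mxKl 0 e) derive0.
Qed.

(** Along the base only the factor f^2 varies, and d(f^2) = 2 f^2 d(ln f). *)
Let Wh_fiber e b b' : ip ('D_(row_mx e 0) Wh y0) (row_mx 0 b) (row_mx 0 b') =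
  2 * (e *m d^T) 0 0 * ip S2 b b'.
Proof.
pose q (z : 'rV[R]_n) : R^o := ip (metric_in g2 x.2 z) b b'.
have dq : differentiable q (rsubmx y0) by exact: ip_const_differentiable.
have df : differentiable fh (lsubmx y0) by rewrite lsub_y0.
pose p1 : 'rV[R]_(m + n) -> R^o := fh \o lsubmx.
pose q1 : 'rV[R]_(m + n) -> R^o := q \o rsubmx.
have dp1 : differentiable p1 y0.
  by apply: differentiable_comp df; exact: differentiable_lsubmx.
have dq1 : differentiable q1 y0.
  by apply: differentiable_comp dq; exact: differentiable_rsubmx.
apply: etrans (@derive_WhE _ _ _ (fun y => p1 y ^+ 2 * q1 y) _) _.
  apply: filterS near_Wh => y ->; rewrite ip_block !ip0r add0r.
  by rewrite /ip -scalemxAr -scalemxAl [LHS]mxE.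
have Dp : 'D_(row_mx e 0) p1 y0 = 'D_e fh yb.
  by apply: etrans (derive_comp_lsubmx _ df) _; rewrite (row_mxKl e 0) lsub_y0.
have Dq : 'D_(row_mx e 0) q1 y0 = 0.
  by apply: etrans (derive_comp_rsubmx _ dq) _; rewrite (row_mxKr e 0) derive0.
apply: etrans (derive_sqr_mul dp1 dq1 Dq) _.
rewrite Dp derive_ln_warping.
have -> : p1 y0 = f x.1 by rewrite /p1 /= lsub_y0 fh_center.
have -> : ip S2 b b' = f x.1 ^+ 2 * q1 y0.
  rewrite /q1 /= /q rsub_y0 (metric_in_center warped_atlasF).
  by rewrite /ip -scalemxAr -scalemxAl [LHS]mxE.
have f0 : f x.1 != 0 by rewrite -fh_center gt_eqF.
by move: ('D_e fh yb) (q1 y0) => D Q; field.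
Qed.

Let ip_Gh u v w : ip (pullback Phi g x) (Gh u v) w =
  2^-1 * (ip ('D_u Wh y0) v w + ip ('D_v Wh y0) u w - ip ('D_w Wh y0) u v).
Proof.
have [gs _ _] := kaehler_metric.
have psym z : (pullback Phi g z)^T = pullback Phi g z by exact: sandwich_sym.
have Wu : Wh y0 \in unitmx by rewrite Wh_center pullback_unit.
by rewrite -Wh_center; exact: ip_christoffel.
Qed.

Let ip_GhE u v w (e1 e2 e3 : R) : ip ('D_u Wh y0) v w = e1 ->
  ip ('D_v Wh y0) u w = e2 -> ip ('D_w Wh y0) u v = e3 ->
  ip (pullback Phi g x) (Gh u v) w = 2^-1 * (e1 + e2 - e3).
Proof. by move=> <- <- <-; exact: ip_Gh. Qed.

(** nabla_X Z has no base component: mixed entries of the metric vanish identically, and the base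
    metric does not vary along the fibres. *)
Let Gh_base_fiber_base a b c :
  ip (pullback Phi g x) (Gh (row_mx a 0) (row_mx 0 b)) (row_mx c 0) = 0.
Proof.
apply: etrans (ip_GhE (Wh_mixed' _ _ _) (Wh_base _ _ _) (Wh_mixed _ _ _)) _.
by rewrite !addr0 subr0 mulr0.
Qed.

(** The one surviving Koszul term is the derivative of the fibre metric along the base; the base
    part of nabla_Z W is - g(Z, W) grad(ln f). *)
Lemma christoffel_fiber b b' c :
  ip (pullback Phi g x) (Gh (row_mx 0 b) (row_mx 0 b')) (row_mx c 0) =
  - (c *m d^T) 0 0 * ip S2 b b'.
Proof.
apply: etrans (ip_GhE (Wh_mixed' _ _ _) (Wh_mixed' _ _ _) (Wh_fiber _ _ _)) _.
by field.
Qed.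

(** The warped product formula nabla_Z X = (X ln f) Z, checked against base and fibre vectors
    separately. *)
Lemma christoffel_mixed b c :
  Gh (row_mx 0 b) (row_mx c 0) = (c *m d^T) 0 0 *: row_mx 0 b.
Proof.
apply: (ip_inj pullback_unit) => w; rewrite -[w]hsubmxK.
have -> : row_mx (lsubmx w) (rsubmx w) = row_mx (lsubmx w) 0 + row_mx 0 (rsubmx w).
  by rewrite add_row_mx addr0 add0r.
rewrite ipDr (ip_GhE (Wh_base _ _ _) (Wh_mixed' _ _ _) (Wh_mixed' _ _ _)).
rewrite (ip_GhE (Wh_mixed _ _ _) (Wh_fiber _ _ _) (Wh_mixed' _ _ _)).
rewrite ipZl ipDr pullback_block !ip_block !ip0l !ip0r -/S2.
by field.
Qed.

(** The base slices are totally geodesic in the warped product: every Koszul term pairing with a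
    fibre vector vanishes. *)
Lemma christoffel_base a c :
  exists e, Gh (row_mx a 0) (row_mx c 0) = row_mx e 0.
Proof.
exists (lsubmx (Gh (row_mx a 0) (row_mx c 0))).
rewrite -[LHS]hsubmxK; congr row_mx.
have S2u : S2 \in unitmx by apply: posdef_unit; exact: fiber_metric_posdef.
apply: (ip_inj S2u) => b; rewrite ip0l.
have := ip_GhE (Wh_mixed _ c b) (Wh_mixed _ a b) (Wh_base b a c).
rewrite addr0 subr0 mulr0 pullback_block -[Gh _ _]hsubmxK ip_block.
by rewrite ip0r add0r hsubmxK.
Qed.

(** The ambient term is the base component of nabla_X Z, which is zero; the subtracted tangential
    term lies in D^T, and J keeps it orthogonal to D^theta. *)
Lemma sff_base_base a c b :
  ip G0 (sff g Phi x (row_mx a 0) (row_mx c 0)) (row_mx 0 b *m T *m Jx) = 0.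
Proof.
rewrite (sffE warped_atlas warped_atlasN _ warped_C2) ipBl.
have [c' cE] := base_invariant x c.
have -> : ip G0 (ambient_sff g Phi x (row_mx a 0) (row_mx c 0)) (row_mx 0 b *m T *m Jx) = 0.
  by apply: etrans (ambient_sff_normal _ _ cE) _; exact: Gh_base_fiber_base.
have [e eE] := christoffel_base a c.
have -> : christoffel (pullback Phi g) x (chart x x) (row_mx a 0) (row_mx c 0) = row_mx e 0.
  exact: eE.
have [e' eE'] := base_invariant x e.
rewrite sub0r; have := kaehler_skew (Phi x) (row_mx e 0 *m T) (row_mx 0 b *m T).
rewrite eE' ip_mulmx => <-.
by rewrite -/(pullback Phi g x) pullback_block ip_block ip0r ip0l addr0.
Qed.

(** The first term is the ambient derivative, evaluated through the base part of nabla_Z W; the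
    second removes its tangential part nabla_Z X = (X ln f) Z, which JW can detect. *)
Lemma sff_fiber_base b c c' b' :
  row_mx c 0 *m T *m Jx = row_mx c' 0 *m T ->
  ip G0 (sff g Phi x (row_mx 0 b) (row_mx c 0)) (row_mx 0 b' *m T *m Jx) =
  - (c' *m d^T) 0 0 * ip S2 b b'
  - (c *m d^T) 0 0 * ip G0 (row_mx 0 b *m T) (row_mx 0 b' *m T *m Jx).
Proof.
move=> cE; rewrite (sffE warped_atlas warped_atlasN _ warped_C2) ipBl.
have -> : ip G0 (ambient_sff g Phi x (row_mx 0 b) (row_mx c 0)) (row_mx 0 b' *m T *m Jx)
    = - (c' *m d^T) 0 0 * ip S2 b b'.
  by apply: etrans (ambient_sff_normal _ _ cE) _; exact: christoffel_fiber.
have -> : christoffel (pullback Phi g) x (chart x x) (row_mx 0 b) (row_mx c 0) =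
    (c *m d^T) 0 0 *: row_mx 0 b by exact: christoffel_mixed.
by rewrite -scalemxAl ipZl.
Qed.

(** f is constant along the fibres, so the differential of ln f has no fibre components, and the
    block diagonal metric adds none when the index is raised. *)
Lemma gradient_warping :
  gradient (warped_metric g1 g2 f) (fun z : M => ln (f z.1)) x =
  row_mx (d *m invmx S1) 0.
Proof.
have S1u : S1 \in unitmx by apply: posdef_unit; exact: base_metric_posdef.
have pu := pullback_unit; rewrite pullback_warped in pu.
rewrite /gradient; set D := \row_i _.
have -> : D = row_mx d 0.
  apply/rowP => i; rewrite [LHS]mxE.
  have df : differentiable (fun y => ln (fh y) : R^o) (lsubmx y0) by rewrite lsub_y0.
  apply: etrans (derive_comp_lsubmx (delta_mx 0 i) df) _; rewrite lsub_y0.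
  case: (split_ordP i) => j ->; rewrite /d /dlog.
    rewrite row_mxEl mxE; congr ('D_ _ _ yb).
    by apply/rowP => l; rewrite !mxE (inj_eq (@lshift_inj _ _)).
  rewrite row_mxEr mxE -[RHS](derive0 (fun y => ln (fh y) : R^o) yb).
  congr ('D_ _ _ yb).
  by apply/rowP => l; rewrite !mxE eq_lrshift andbF.
apply: (canLR (mulmxK pu)).
by rewrite mul_row_block !mulmx0 mul0mx !addr0 mulmxKV.
Qed.

End WarpedSemiSlant.

(** * Traces of bilinear maps and umbilicity *)

Lemma linear_sum_rowE (R : realType) n k (L : 'rV[R]_n -> 'rV[R]_k) u : linear L ->
  L u = \sum_i u 0 i *: L (delta_mx 0 i).
Proof.
move=> /linear_rowE[A LA]; rewrite LA mulmx_sum_row.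
by apply: eq_bigr => i _; rewrite LA -rowE.
Qed.

(** Reduces the trace of h to traces of scalar bilinear forms, for which [frame_change] with
    [L := id] shows independence of the frame. *)
Lemma bilinear_coordE (R : realType) n k (h : 'rV[R]_n -> 'rV[R]_n -> 'rV[R]_k) j :
  (forall v, linear (h^~ v)) -> (forall u, linear (h u)) ->
  exists Q : 'M[R]_n, forall u v, h u v 0 j = ip Q u v.
Proof.
move=> l1 l2; exists (\matrix_(a, b) h (delta_mx 0 a) (delta_mx 0 b) 0 j) => u v.
rewrite ipE (linear_sum_rowE u (l1 v)) summxE; apply: eq_bigr => a _.
rewrite mxE (linear_sum_rowE v (l2 _)) summxE mulr_sumr; apply: eq_bigr => b _.
by rewrite !mxE; ring.
Qed.

(** Tracing the relation over an orthonormal frame identifies H with the mean curvature vector. *)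
Lemma totally_umbilical_intro (R : realType) m n (M : charted_space R m)
    (N : charted_space R n) (g : N -> 'M[R]_n) (F : M -> N) :
  (forall x, exists H, forall u v, sff g F x u v = ip (pullback F g x) u v *: H) ->
  totally_umbilical g F.
Proof.
move=> umb x E SE u v; have [H HE] := umb x.
rewrite HE /mean_curvature.
have one i : ip (pullback F g x) (row i E) (row i E) = 1.
  have -> : ip (pullback F g x) (row i E) (row i E) = (E *m pullback F g x *m E^T) i i.
    by rewrite -[RHS]ip_delta -ip_mulmx !rowE.
  by move: SE; rewrite /orthonormal_basis => ->; rewrite mxE eqxx.
have -> : \sum_i sff g F x (row i E) (row i E) = m%:R *: H.
  rewrite (eq_bigr (fun=> H)) => [|i _]; last by rewrite HE one scale1r.
  by rewrite sumr_const card_ord scaler_nat.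
(* In dimension 0 the factor [m%:R^-1] is 0 and cannot be cancelled, but then the inner product is
   an empty sum. *)
have [m0|m0] := eqVneq (m%:R : R) 0.
  have -> : ip (pullback F g x) u v = 0; last by rewrite !scale0r.
  move/eqP: m0; rewrite pnatr_eq0 => /eqP m0.
  by rewrite ipE big1// => i; have := ltn_ord i; rewrite [X in (_ < X)%N]m0.
by rewrite scalerK.
Qed.

(** * The inequality and the equality case *)

Section Conclusion.
Context {R : realType} {m n : nat}.
Variables (N : charted_space R (m + 2 * n)) (g J : N -> 'M[R]_(m + 2 * n)).
Variables (B : charted_space R m) (F : charted_space R n).
Variables (g1 : B -> 'M[R]_m) (g2 : F -> 'M[R]_n) (f : B -> R).
Let M := prod_space B F.
Variables (Phi : M -> N) (theta : M -> R).
Hypothesis (kN : kaehler g J) (hM : warped_semi_slant g1 g2 g J f Phi theta).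
Hypothesis hsin : forall x, sin (theta x) != 0.

Let aB : atlas B := warped_atlasB hM.
Let aF : atlas F := warped_atlasF hM.
Let aM : atlas M := warped_atlas hM.
Let aN : atlas N := warped_atlasN kN.
Let cP : C2_map Phi := warped_C2 hM.
Let gR : riemannian_metric g := kaehler_metric kN.

Section AtPoint.
Variable x : M.
Let T := tangent_map Phi x.
Let G0 := g (Phi x).
Let Jx := J (Phi x).
Let S1 := g1 x.1.
Let S2 := f x.1 ^+ 2 *: g2 x.2.
Let h := sff g Phi x.
Let d := dlog f x.1.

Let Gs : G0^T = G0. Proof. by have [H _ _] := gR; exact: H. Qed.
Let Gp v : v != 0 -> 0 < ip G0 v v. Proof. by have [_ H _] := gR; exact: H. Qed.
Let JJ : Jx *m Jx = - 1%:M. Proof. by have [_ _ _ [H _ _]] := kN; exact: H. Qed.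
Let JG u v : ip G0 (u *m Jx) (v *m Jx) = ip G0 u v.
Proof. exact: kaehler_isometry kN _ _ _. Qed.
Let TGT : T *m G0 *m T^T = block_mx S1 0 0 S2.
Proof. exact: pullback_block hM x. Qed.

Let CJ : (row_mx 1%:M 0 *m T *m Jx <= (row_mx 1%:M 0 : 'M[R]_(m, m + n)) *m T)%MS.
Proof. by have [_ _ _ _ [_ _ /(_ x)/andP[H _] _]] := hM. Qed.

Let slant (X : 'rV[R]_n) : X != 0 -> subspace_angle G0
  (X *m (row_mx 0 1%:M *m T) *m Jx) ((row_mx 0 1%:M : 'M[R]_(n, m + n)) *m T) (theta x).
Proof.
have [_ _ _ _ [_ _ _ sl]] := hM => X0.
have := sl x (X *m @tangent_fiber R m n B F x); rewrite !mulmxA; apply.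
  exact: submxMl.
apply: contra X0 => /eqP/(f_equal rsubmx).
by rewrite /tangent_fiber mul_mx_row mulmx0 mulmx1 row_mxKr linear0 => ->.
Qed.

Let S1p v : v != 0 -> 0 < ip S1 v v. Proof. exact: (base_metric_posdef hM). Qed.
Let S2p v : v != 0 -> 0 < ip S2 v v. Proof. exact: (fiber_metric_posdef hM x). Qed.
Let pu : pullback Phi g x \in unitmx. Proof. exact: (pullback_unit hM x). Qed.
Let hsym u v : h u v = h v u. Proof. exact: (sff_sym aM aN cP gR pu). Qed.
Let hlin v : linear (h^~ v). Proof. exact: (sff_linear aM aN g cP x v). Qed.
Let hlin' u : linear (h u). Proof. by move=> a v w; rewrite !(hsym u) hlin. Qed.
Let hn u v w : ip G0 (h u v) (w *m T) = 0.
Proof. exact: (sff_normal aM aN cP gR pu). Qed.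
Let hTT a c b : ip G0 (h (row_mx a 0) (row_mx c 0)) (row_mx 0 b *m T *m Jx) = 0.
Proof. exact: (sff_base_base kN hM). Qed.
Let hFT b c c' b' : row_mx c 0 *m T *m Jx = row_mx c' 0 *m T ->
  ip G0 (h (row_mx 0 b) (row_mx c 0)) (row_mx 0 b' *m T *m Jx) =
  - (c' *m d^T) 0 0 * ip S2 b b'
  - (c *m d^T) 0 0 * ip G0 (row_mx 0 b *m T) (row_mx 0 b' *m T *m Jx).
Proof. exact: (sff_fiber_base kN hM). Qed.

Lemma warped_sff_base a c : sff g Phi x (row_mx a 0) (row_mx c 0) = 0.
Proof.
exact: (sff_base_eq0 Gs Gp JJ JG TGT CJ slant (hsin x) S1p S2p hn hTT).
Qed.

(** Raising the index of d by [S1] preserves its norm, so the gradient has the dual norm that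
    [sff_sqnorm_ge] produces. *)
Lemma tnorm_gradient_sqr :
  tnorm (warped_metric g1 g2 f x)
    (gradient (warped_metric g1 g2 f) (fun z : M => ln (f z.1)) x) ^+ 2 =
  ip (invmx S1) d d.
Proof.
have S1u : S1 \in unitmx by exact: posdef_unit.
have S1s : S1^T = S1 by have [[_ [H _ _]] _ _ _ _] := hM; exact: H.
rewrite (gradient_warping hM) /tnorm.
have -> : ip (warped_metric g1 g2 f x) (row_mx (d *m invmx S1) 0)
    (row_mx (d *m invmx S1) 0) = ip S1 (d *m invmx S1) (d *m invmx S1).
  by rewrite /warped_metric ip_block ip0l addr0.
rewrite sqr_sqrtr.
  by rewrite ip_mulmx trmx_inv S1s mulVmx// mul1mx.
by have [->|/S1p/ltW//] := eqVneq (d *m invmx S1) 0; rewrite ip0l.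
Qed.

Let bound : R :=
  2 * n%:R * ((sin (theta x))^-1 ^+ 2 + (cos (theta x) / sin (theta x)) ^+ 2)
  * tnorm (warped_metric g1 g2 f x)
      (gradient (warped_metric g1 g2 f) (fun z : M => ln (f z.1)) x) ^+ 2.

Lemma warped_sff_sqnorm_ge E : orthonormal_basis (pullback Phi g x) E ->
  bound <= sff_sqnorm g Phi x E.
Proof.
rewrite (pullback_block hM) /bound tnorm_gradient_sqr => SE.
exact: (sff_sqnorm_ge Gs Gp JJ JG TGT CJ slant (hsin x) S1p S2p hsym hlin hn hTT hFT SE).
Qed.

Lemma warped_sff_fiber :
  (forall E, orthonormal_basis (pullback Phi g x) E -> sff_sqnorm g Phi x E = bound) ->
  forall b b', sff g Phi x (row_mx 0 b) (row_mx 0 b') = 0.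
Proof.
rewrite /bound tnorm_gradient_sqr (pullback_block hM) => heq.
exact: (sff_fiber_eq0 Gs Gp JJ JG TGT CJ slant (hsin x) S1p S2p hsym hlin hn hTT hFT heq).
Qed.

(** In an adapted frame the trace runs over diagonal entries only, all of which lie in the two pure
    blocks; the mixed part of h does not contribute. *)
Lemma warped_mean_curvature E :
  (forall b b', sff g Phi x (row_mx 0 b) (row_mx 0 b') = 0) ->
  orthonormal_basis (pullback Phi g x) E -> mean_curvature g Phi x E = 0.
Proof.
rewrite (pullback_block hM) => hFF SE; rewrite /mean_curvature.
have S1s : S1^T = S1 by have [[_ [H _ _]] _ _ _ _] := hM; exact: H.
have S2s : S2^T = S2.
  by have [_ [_ [H _ _]] _ _ _] := hM; rewrite /S2 linearZ /= H.
have [E1 SE1] := orthonormal_basis_exists S1s S1p.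
have [E2 SE2] := orthonormal_basis_exists S2s S2p.
have SE0 := adapted_frame SE1 SE2.
have Su : block_mx S1 0 0 S2 \in unitmx by rewrite -(pullback_block hM).
have -> : \sum_i sff g Phi x (row i E) (row i E) = 0; last exact: scaler0.
apply/rowP => j; rewrite summxE mxE.
have [Q QE] := bilinear_coordE j hlin hlin'.
under eq_bigr do rewrite QE.
rewrite (frame_change Q Su SE SE0 (L := id))//.
apply: big1 => i _; rewrite -QE; case: (split_ordP i) => i' ->.
  by rewrite frame_row_up /h warped_sff_base mxE.
by rewrite frame_row_down /h hFF mxE.
Qed.

End AtPoint.

(** As h vanishes on D^T, the second fundamental form of the slice comes from the warped product
    connection. That part lies in D^T, so it is tangent to the slice as well as normal to it. *)
Lemma base_slice_totally_geodesic (q : F) : totally_geodesic g (base_slice Phi q).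
Proof.
move=> p u v.
pose s (p : B) : M := (p, q).
pose L : 'M[R]_(m, m + n) := row_mx 1%:M 0.
pose c (p : B) : 'rV[R]_(m + n) := row_mx 0 (chart q q).
have cs : continuous s.
  by move=> z; apply: cvg_pair; [exact: cvg_id|exact: cvg_cst].
have uL w : w *m L = row_mx w 0 by rewrite /L mul_mx_row mulmx1 mulmx0.
have qq := chart_dom_refl aF q.
have sE p' y : chart_img p' y -> chart_img (s p') (y *m L + c p') /\
    param (s p') (y *m L + c p') = s (param p' y).
  move=> py; rewrite uL add_row_mx addr0 add0r; split.
    by apply/prod_chart_img; rewrite row_mxKl row_mxKr; split=> //; exact: chart_img_chart.
  by rewrite /= row_mxKl row_mxKr (chartK aF).
have g1p w : w != 0 -> 0 < ip (g1 p) w w by exact: (base_metric_posdef hM (s p)).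
have g1u : g1 p \in unitmx by exact: posdef_unit.
have pu : pullback (Phi \o s) g p \in unitmx.
  rewrite (slice_pullback aB aM aN cs sE g cP) (pullback_block hM).
  rewrite /L mul_row_block tr_row_mx mul_row_col trmx0 trmx1.
  by rewrite !(mulmx0, mulmx1, mul1mx, mul0mx, addr0).
have h0 : sff g Phi (s p) (u *m L) (v *m L) = 0 by rewrite !uL warped_sff_base.
have [w wE wn] := slice_sff aB aM aN cs sE cP gR pu h0.
apply: etrans wE _; move: wn; rewrite !uL.
have [e ->] := christoffel_base kN hM (s p) u v.
rewrite opp_row_mx add_row_mx subr0 => wn.
have -> : e - w = 0; last by rewrite row_mx0 mul0mx.
apply: (ip_inj g1u) => z; rewrite ip0l -(wn z) uL (pullback_block hM) ip_block.
by rewrite ip0r addr0.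
Qed.

(** With h zero on D^theta, what remains is the part of nabla_Z W normal to the fibre, proportional
    to g(Z, W) by [christoffel_fiber]. *)
Lemma fiber_slice_totally_umbilical (p : B) :
  (forall q b b', sff g Phi (p, q) (row_mx 0 b) (row_mx 0 b') = 0) ->
  totally_umbilical g (fiber_slice Phi p).
Proof.
move=> hFF; apply: totally_umbilical_intro => q.
pose s (q : F) : M := (p, q).
pose L : 'M[R]_(n, m + n) := row_mx 0 1%:M.
pose c (q : F) : 'rV[R]_(m + n) := row_mx (chart p p) 0.
have cs : continuous s.
  by move=> z; apply: cvg_pair; [exact: cvg_cst|exact: cvg_id].
have uL w : w *m L = row_mx 0 w by rewrite /L mul_mx_row mulmx1 mulmx0.
have pp := chart_dom_refl aB p.
have sE q' y : chart_img q' y -> chart_img (s q') (y *m L + c q') /\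
    param (s q') (y *m L + c q') = s (param q' y).
  move=> qy; rewrite uL add_row_mx addr0 add0r; split.
    by apply/prod_chart_img; rewrite row_mxKl row_mxKr; split=> //; exact: chart_img_chart.
  by rewrite /= row_mxKl row_mxKr (chartK aB).
set S2 := f p ^+ 2 *: g2 q.
have S2p w : w != 0 -> 0 < ip S2 w w by exact: (fiber_metric_posdef hM (s q)).
have S2u : S2 \in unitmx by exact: posdef_unit.
have pE : pullback (Phi \o s) g q = S2.
  rewrite (slice_pullback aF aM aN cs sE g cP) (pullback_block hM).
  rewrite /L mul_row_block tr_row_mx mul_row_col trmx0 trmx1.
  by rewrite !(mulmx0, mulmx1, mul1mx, mul0mx, addr0, add0r).
have pu : pullback (Phi \o s) g q \in unitmx by rewrite pE.
have g1u : g1 p \in unitmx.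
  by apply: posdef_unit => w; exact: (base_metric_posdef hM (s q)).
(* The normal curvature vector is the image of - grad(ln f). *)
exists (row_mx (- (dlog f p *m invmx (g1 p))) 0 *m tangent_map Phi (s q)) => u v.
have h0 : sff g Phi (s q) (u *m L) (v *m L) = 0 by rewrite !uL hFF.
have [w wE wn] := slice_sff aF aM aN cs sE cP gR pu h0.
have -> : ip (pullback (fiber_slice Phi p) g q) u v = ip S2 u v by rewrite -pE.
apply: etrans wE _; rewrite scalemxAl; apply: (f_equal (mulmx^~ _)).
move: wn; rewrite !uL; set Gam := christoffel _ _ _ _ _.
have GamE e : ip (pullback Phi g (s q)) Gam (row_mx e 0) = - (e *m (dlog f p)^T) 0 0 * ip S2 u v.
  exact: (christoffel_fiber kN hM).
move: Gam GamE => Gam; rewrite -[Gam]hsubmxK.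
move: (lsubmx Gam) (rsubmx Gam) => a b GamE.
rewrite opp_row_mx add_row_mx oppr0 addr0 => wn.
(* The fibre component is tangent to the slice and also normal to it; only the base component [a]
   survives. *)
have -> : b - w = 0.
  apply: (ip_inj S2u) => z; rewrite ip0l -(wn z) uL (pullback_block hM) ip_block.
  by rewrite ip0r add0r.
have -> : a = - (ip S2 u v *: (dlog f p *m invmx (g1 p))).
  apply: (ip_inj g1u) => e; have := GamE e.
  rewrite (pullback_block hM) ip_block ip0r addr0 => ->.
  rewrite ipNl ipZl mulNr mulrC; congr (- (_ * _)).
  by rewrite /ip mulmxKV// -[in RHS](trmxK (dlog f p)) -trmx_mul [RHS]mxE.
by rewrite scale_row_mx scaler0 scalerN.
Qed.

End Conclusion.

Theorem theorem5p2 (R : realType) (m n : nat)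
    (Mbar : charted_space R (m + 2 * n)%N)
    (g J : Mbar -> 'M[R]_(m + 2 * n))
    (MT : charted_space R m) (Mtheta : charted_space R n)
    (gT : MT -> 'M[R]_m) (gtheta : Mtheta -> 'M[R]_n)
    (f : MT -> R)
    (Phi : prod_space MT Mtheta -> Mbar)
    (theta : prod_space MT Mtheta -> R)
    (hMbar : kaehler g J)
    (hM : warped_semi_slant gT gtheta g J f Phi theta)
    (hf : ~ exists c : R, forall p : MT, f p = c)
    (hT : forall q : Mtheta, holomorphic J (base_slice Phi q))
    (htheta : forall p : MT,
      proper_slant_submanifold g J (fiber_slice Phi p) (fun q => theta (p, q)))
    (hsin : forall x, sin (theta x) != 0) :
  let bound (x : prod_space MT Mtheta) : R :=
    2 * n%:R * ((sin (theta x))^-1 ^+ 2 + (cos (theta x) / sin (theta x)) ^+ 2)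
    * tnorm (warped_metric gT gtheta f x)
        (gradient (warped_metric gT gtheta f) (fun z => ln (f z.1)) x) ^+ 2 in
  (forall x E, orthonormal_basis (pullback Phi g x) E ->
     bound x <= sff_sqnorm g Phi x E) /\
  ((forall x E, orthonormal_basis (pullback Phi g x) E ->
      sff_sqnorm g Phi x E = bound x) ->
   [/\ forall q : Mtheta, totally_geodesic g (base_slice Phi q),
       forall p : MT, totally_umbilical g (fiber_slice Phi p)
     & minimal g Phi]).
Proof.
move=> bound; split=> [x E|eq_bound].
  exact: (warped_sff_sqnorm_ge hMbar hM hsin).
have hFF x b b' : sff g Phi x (row_mx 0 b) (row_mx 0 b') = 0.
  exact: (warped_sff_fiber hMbar hM hsin (eq_bound x)).
split=> [q|p|x E].
- exact: (base_slice_totally_geodesic hMbar hM hsin).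
- by apply: (fiber_slice_totally_umbilical hMbar hM) => q; exact: hFF.
- exact: (warped_mean_curvature hMbar hM hsin (hFF x)).
Qed.
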